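(* Let $\mathcal X=\{x_1,\dots,x_K\}$ be a finite metric space with metric $d$ and $\delta=\min_{i\ne j}d(x_i,x_j)$. Let $X^P,X^Q$ be independent Markov chains on $\mathcal X$ with irreducible, aperiodic and reversible transition matrices $P=(p_{i,j})$, $Q=(q_{i,j})$, invariant distribution vectors $(\pi^P_i)_{i\in[K]}$, $(\pi^Q_i)_{i\in[K]}$, and initial distributions $\mu^P=(\mu^P_i)_{i\in[K]}$, $\mu^Q=(\mu^Q_i)_{i\in[K]}$. Let $\lambda(P),\lambda(Q)<1$ denote the second largest absolute eigenvalues of $P$ and $Q$, and set $\kappa(P)=\max_{i\in[K]}\mu^P_i/\pi^P_i$, $\kappa(Q)=\max_{i\in[K]}\mu^Q_i/\pi^Q_i$. Assume $n_P\ge(1-\lambda(P)^2)^{-1}$ and $n_Q\ge(1-\lambda(Q)^2)^{-1}$. Let $$\mathfrak C'(P,Q,\mu^P,\mu^Q)=12\max\big\{3\kappa(P)\kappa(Q)(1-(\lambda(P)\vee\lambda(Q))^2)^{-1},\ 28\big(\kappa(P)(1-\lambda(P)^2)^{-1}\vee\kappa(Q)(1-\lambda(Q)^2)^{-1}\big)\big\},$$ $$n_{\mathrm{eff}}=\frac{n_P}{\max_{i\in[K]}\pi^Q_i/\pi^P_i}+n_Q,\qquad \overline L=\frac{\max_{i,j\in[K]}|f^\ast(x_i)-f^\ast(x_j)|}{\delta}.$$ Then, for the choice $h_n=c(n_{\mathrm{eff}}^{-1/2}\wedge\delta)$ with some $c\in(0,1)$, the Nadaraya--Watson estimator $\hat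 f_n$ in the $(P,Q)$-covariate shift regression model (see context) satisfies $$\mathbb E\Big[\big\lVert\hat f_n-f^\ast\big\rVert^2_{L^2(\pi^Q)}\Big]\le\frac{c^2\overline L^2+K\max_{i\in[K]}\frac{\pi^Q_i}{\pi^P_i}\,\mathfrak C'(P,Q,\mu^P,\mu^Q)\,(\lVert f^\ast\rVert_\infty^2+\sigma^2)}{n_{\mathrm{eff}}}.$$
   Context: $[K]=\{1,\dots,K\}$, $a\vee b=\max\{a,b\}$, $a\wedge b=\min\{a,b\}$. Reversibility means $\pi^P_ip_{i,j}=\pi^P_jp_{j,i}$ and $\pi^Q_iq_{i,j}=\pi^Q_jq_{j,i}$ for all $i,j$. Regression model. For $n_P,n_Q\in\mathbb N$ and $n=n_P+n_Q$ one observes $(X_i,Y_i)_{i=1,\dots,n}$ with $X_i=X^P_{i-1}$ for $1\le i\le n_P$, $X_i=X^Q_{i-1-n_P}$ for $n_P+1\le i\le n$, and $Y_i=f^\ast(X_i)+\xi_i$, where $f^\ast:\mathcal X\to\mathbb R$ is the regression function and $\xi_i=\xi^P_{i-1}$ for $i\le n_P$, $\xi_i=\xi^Q_{i-1-n_P}$ for $i>n_P$. The square integrable noise sequences $\xi^P=(\xi^P_i)_{i\in\mathbb N_0}$, $\xi^Q=(\xi^Q_i)_{i\in\mathbb N_0}$ satisfy: (1) $(X^P,\xi^P)$ and $(X^Q,\xi^Q)$ are independent; (2) for $R\in\{P,Q\}$ the elements of $\xi^R$ are conditionally independent given $X^R$; (3) for some $\sigma>0$, for $R\in\{P,Q\}$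 and all $i$, almost surely $\mathbb E[\xi^R_i\mid X^R]=0$ and $\mathbb E[(\xi^R_i)^2\mid X^R]\le\sigma^2$. Estimator. $\hat f_n(x)=\frac{\sum_{i=1}^nY_i\mathbf 1_{B(x,h_n)}(X_i)}{\sum_{i=1}^n\mathbf 1_{B(x,h_n)}(X_i)}$ if the denominator is positive and $\hat f_n(x)=0$ otherwise, where $B(x,r)=\{y\in\mathcal X:d(x,y)\le r\}$. Since $h_n<\delta$, $B(x,h_n)=\{x\}$. *)

(* Defs.v *)
From HB Require Import structures.
From mathcomp Require Import all_boot all_order all_algebra.
From mathcomp Require Import complex.
From mathcomp Require Import all_classical all_reals all_analysis.

Set Implicit Arguments.
Unset Strict Implicit.
Unset Printing Implicit Defensive.

Import Order.TTheory GRing.Theory Num.Theory.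
Import numFieldNormedType.Exports.

Local Open Scope classical_set_scope.
Local Open Scope ring_scope.

Section TransitionMatrices.
Variables (R : realType) (K : nat).
Implicit Types (M : 'M[R]_K) (pi mu : 'rV[R]_K).

Definition distribution_vector mu : Prop :=
  (forall i, 0 <= mu 0 i) /\ \sum_i mu 0 i = 1.

Definition stochastic M : Prop :=
  (forall i j, 0 <= M i j) /\ forall i, \sum_j M i j = 1.

Definition irreducible M : Prop :=
  forall i j, exists m : nat, (0 < m)%N /\ 0 < (M ^+ m) i j.

(* Every common divisor of the return times to a state is 1. *)
Definition aperiodic M : Prop :=
  forall (i : 'I_K) (g : nat),
    (forall m : nat, (0 < m)%N -> 0 < (M ^+ m) i i -> (g %| m)%N) -> g = 1%N.

Definition invariant_distribution M pi : Prop :=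
  distribution_vector pi /\ pi *m M = pi.

Definition reversible M pi : Prop :=
  forall i j, pi 0 i * M i j = pi 0 j * M j i.

(* The roots of the characteristic polynomial in R[i], with multiplicity. *)
Definition eigenvalues M : seq R[i] :=
  sval (closed_field_poly_normal (char_poly (map_mx (real_complex R) M))).

(* Eigenvalues are counted with multiplicity, so that the list below has K
   entries, the largest one being 1 for a stochastic matrix. *)
Definition second_abs_eigenvalue M : R :=
  nth 0 (sort >=%O [seq complex.Re `|z| | z <- eigenvalues M]) 1.

Definition max_ratio (u v : 'rV[R]_K) : R :=
  \big[Num.max/0]_i (u 0 i / v 0 i).

End TransitionMatrices.

Section ConditionalExpectation.
Context {d : measure_display} {Omega : measurableType d} {R : realType}.
Variable Pr : probability Omega R.
Implicit Types (G H : set (set Omega)) (f g : Omega -> R).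

(* [g] is a version of the conditional expectation of [f] given the
   sigma-algebra [G]. *)
Definition is_cond_expectation G f g : Prop :=
  [/\ Pr.-integrable setT (EFin \o f),
      Pr.-integrable setT (EFin \o g),
      forall B : set R, measurable B -> G (g @^-1` B)
    & forall A, G A ->
        (\int[Pr]_(w in A) (g w)%:E = \int[Pr]_(w in A) (f w)%:E)%E].

(* For Borel sets B_i, the Z_i are versions of Pr(xi_i \in B_i | G); the
   conditional product rule is required for every finite subfamily. *)
Definition cond_independent G (xi : nat -> Omega -> R) : Prop :=
  forall B : nat -> set R, (forall i, measurable (B i)) ->
  exists Z : nat -> Omega -> R,
    (forall i, is_cond_expectation G (\1_(xi i @^-1` B i)) (Z i)) /\
    forall s : seq nat, uniq s ->
      is_cond_expectation G (\1_(\bigcap_(i in [set` s]) (xi i @^-1` B i)))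
        (fun w => \prod_(i <- s) Z i w).

Definition independent_systems G H : Prop :=
  forall A B, G A -> H B -> (Pr (A `&` B) = Pr A * Pr B)%E.

End ConditionalExpectation.

Section Processes.
Context {d : measure_display} {Omega : measurableType d} {R : realType}.
Variables (Pr : probability Omega R) (T : metricType R).
Implicit Types (X : nat -> Omega -> T) (xi : nat -> Omega -> R).

(* The finite state space T carries the discrete sigma-algebra. *)
Definition sigma_chain X : set (set Omega) :=
  <<s \bigcup_t preimage_set_system setT (X t) setT >>.

Definition sigma_chain_noise X xi : set (set Omega) :=
  <<s (\bigcup_t preimage_set_system setT (X t) setT) `|`
      (\bigcup_t preimage_set_system setT (xi t) measurable) >>.

(* The Markov property is written in product form, which avoids conditioning
   on null events. *)
Definition markov_chain (K : nat) (x : 'I_K -> T) (mu : 'rV[R]_K)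
    (M : 'M[R]_K) X : Prop :=
  [/\ forall t (A : set T), measurable (X t @^-1` A),
      forall i, Pr [set w | X 0 w = x i] = (mu 0 i)%:E
    & forall (t : nat) (i : nat -> 'I_K) (j : 'I_K),
        let past := [set w | forall s, (s <= t)%N -> X s w = x (i s)] in
        Pr (past `&` [set w | X t.+1 w = x j])
          = (Pr past * (M (i t) j)%:E)%E].

Definition noise_given_chain X xi (sigma : R) : Prop :=
  [/\ forall i, xi i \in Lfun Pr 2%:E,
      cond_independent Pr (sigma_chain X) xi,
      forall i, exists2 m, is_cond_expectation Pr (sigma_chain X) (xi i) m
        & {ae Pr, forall w, m w = 0}
    & forall i, exists2 v,
        is_cond_expectation Pr (sigma_chain X) (fun w => xi i w ^+ 2) v
        & {ae Pr, forall w, v w <= sigma ^+ 2}].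

(* Observations are numbered from 0: the first nP come from the first
   sequence, the following ones from the second. *)
Definition concat_sample (S : Type) (nP : nat) (ZP ZQ : nat -> Omega -> S)
    (i : nat) (w : Omega) : S :=
  if (i < nP)%N then ZP i w else ZQ (i - nP)%N w.

Definition closed_metric_ball (y : T) (r : R) : set T :=
  [set z | mdist y z <= r].

Definition nadaraya_watson (n : nat) (h : R) (X : nat -> Omega -> T)
    (Y : nat -> Omega -> R) (w : Omega) (y : T) : R :=
  let N := \sum_(i < n) \1_(closed_metric_ball y h) (X i w) in
  if 0 < N then
    (\sum_(i < n) Y i w * \1_(closed_metric_ball y h) (X i w)) / N
  else 0.

End Processes.

Section FiniteMetricSpace.
Variables (R : realType) (T : metricType R) (K : nat) (x : 'I_K -> T).

(* An infimum over a finite set, hence a minimum as soon as 2 <= K. *)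
Definition min_dist : R :=
  inf [set r | exists i j, i != j /\ r = mdist (x i) (x j)].

Definition max_osc (f : T -> R) : R :=
  \big[Num.max/0]_i \big[Num.max/0]_j `|f (x i) - f (x j)|.

Definition Lbar (f : T -> R) : R := max_osc f / min_dist.

Definition sup_norm (f : T -> R) : R := \big[Num.max/0]_i `|f (x i)|.

Definition sq_L2_norm (pi : 'rV[R]_K) (f : T -> R) : R :=
  \sum_i pi 0 i * f (x i) ^+ 2.

End FiniteMetricSpace.

Section Constants.
Variables (R : realType) (K : nat).
Implicit Types (P Q : 'M[R]_K) (piP piQ muP muQ : 'rV[R]_K).

Definition effective_size (nP nQ : nat) piP piQ : R :=
  nP%:R / max_ratio piQ piP + nQ%:R.

Definition constC P Q muP muQ piP piQ : R :=
  let lP := second_abs_eigenvalue P in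
  let lQ := second_abs_eigenvalue Q in
  let kP := max_ratio muP piP in
  let kQ := max_ratio muQ piQ in
  12 * Num.max (3 * kP * kQ * (1 - Num.max lP lQ ^+ 2)^-1)
               (28 * Num.max (kP * (1 - lP ^+ 2)^-1) (kQ * (1 - lQ ^+ 2)^-1)).

End Constants.

(* Main.v *)
(**
Fix a state [x j]. Since [h] is below the minimal distance, the estimator there
only averages the observations made at visits of [x j]. With [c] the total
number of visits and [AP], [AQ] the sums of the noise over the visits of the two
chains, the squared error is at most [1_(c = 0) * |f|^2 + 2 (AP^2 + AQ^2) / c^2].

Given a chain, its noise variables are centered, uncorrelated and of variance at
most [sigma^2], and they are independent of the other chain, so that the second
term has expectation at most [2 sigma^2 E[1_(c > 0) / c]]. Both this quantity and
[P (c = 0)] are bounded, with [m = nP * piP j + nQ * piQ j], by means of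
[1 / c <= 2 / m + 4 (c - m)^2 / m^2] and [1_(c = 0) <= (c - m)^2 / m^2].

The mean square deviation of the visit count of one chain from [n * pi j] is at
most [max (mu / pi)] times its value for the stationary chain, because as a
function of the initial state it is nonnegative. The stationary value is a sum of
autocovariances, which decay like powers of the second largest absolute
eigenvalue, by diagonalizing the symmetric matrix
[sqrt pi_i * p_ij / sqrt pi_j]. This eigenvalue is less than 1 by irreducibility
and aperiodicity. Finally [piQ j / m <= 1 / neff] for every [j].
*)
Require Import Defs.
From HB Require Import structures.
From mathcomp Require Import all_boot all_order all_algebra.
From mathcomp Require Import complex ring lra zify.
From mathcomp Require Import all_classical all_reals all_analysis.
From mathcomp Require Import measurable_realfun.

Set Implicit Arguments.
Unset Strict Implicit.
Unset Printing Implicit Defensive.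

Import Order.TTheory GRing.Theory Num.Theory.
Import numFieldNormedType.Exports.

Local Open Scope classical_set_scope.
Local Open Scope ring_scope.

(** * Reversible Markov matrices *)

Lemma mulmxS (R : pzRingType) n (M : 'M[R]_n) k : M ^+ k.+1 = M *m M ^+ k.
Proof. exact: exprS. Qed.

Section ReversibleForms.
Variables (R : realType) (K : nat).
Implicit Types (M : 'M[R]_K) (pi : 'rV[R]_K) (g h : 'cV[R]_K).

Definition wdot pi g h : R := \sum_i pi 0 i * g i 0 * h i 0.

Lemma stochastic_exp M k : stochastic M -> stochastic (M ^+ k).
Proof.
move=> [M0 M1]; elim: k => [|k [IH0 IH1]].
  split=> [i j|i]; first by rewrite expr0 mxE ler0n.
  rewrite expr0 (bigD1 i)//= big1 ?addr0 ?mxE ?eqxx// => j ji.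
  by rewrite mxE eq_sym (negbTE ji).
rewrite mulmxS; split=> [i j|i]; first by rewrite mxE sumr_ge0// => l _; rewrite mulr_ge0.
under eq_bigr do rewrite mxE.
rewrite exchange_big/= -[RHS](M1 i); apply: eq_bigr => l _.
by rewrite -mulr_sumr IH1 mulr1.
Qed.

Lemma invariant_exp M pi k : pi *m M = pi -> pi *m M ^+ k = pi.
Proof.
move=> piM; elim: k => [|k IH]; first by rewrite expr0 mulmx1.
by rewrite mulmxS mulmxA piM.
Qed.

Lemma wdot_mulmx M pi g h :
  wdot pi g (M *m h) = \sum_i \sum_j pi 0 i * M i j * (g i 0 * h j 0).
Proof.
by apply: eq_bigr => i _; rewrite mxE mulr_sumr; apply: eq_bigr => j _; ring.
Qed.

(* The Dirichlet form of [M] when [e = 1], of [- M] when [e = -1]. *)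
Lemma dirichlet_form M pi g (e : R) : stochastic M -> pi *m M = pi -> e ^+ 2 = 1 ->
  \sum_i \sum_j pi 0 i * M i j * (g i 0 - e * g j 0) ^+ 2
    = 2 * (wdot pi g g - e * wdot pi g (M *m g)).
Proof.
move=> [M0 M1] piM e2.
have E1 : \sum_i \sum_j pi 0 i * M i j * g i 0 ^+ 2 = wdot pi g g.
  apply: eq_bigr => i _; rewrite -mulr_suml -mulr_sumr M1; ring.
have E2 : \sum_i \sum_j pi 0 i * M i j * g j 0 ^+ 2 = wdot pi g g.
  rewrite exchange_big; apply: eq_bigr => j _; rewrite -mulr_suml.
  have /matrixP/(_ 0 j) := piM; rewrite mxE => ->; ring.
rewrite wdot_mulmx mulrBr mulr2n mulrDl mul1r -{1}E1 -{1}E2.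
rewrite mulr_sumr [X in _ - X]mulr_sumr -big_split -sumrB; apply: eq_bigr => i _.
rewrite mulr_sumr [X in _ - X]mulr_sumr -big_split -sumrB; apply: eq_bigr => j _.
rewrite /= sqrrB exprMn e2; ring.
Qed.

(** If [pi 0 j] were zero, every term [pi 0 i * (M ^+ m) i j] of the invariance equation for
    [M ^+ m] would vanish. Irreducibility gives, for each [i], an [m] with a positive entry, so all
    of [pi] would be zero. *)
Lemma invariant_gt0 M pi : irreducible M -> stochastic M ->
  invariant_distribution M pi -> forall i, 0 < pi 0 i.
Proof.
move=> irrM stM [[pi0 pi1] piM] j; rewrite lt0r pi0 andbT.
apply/eqP => pij0.
suff : \sum_i pi 0 i = 0 by rewrite pi1 => /eqP; rewrite oner_eq0.
apply: big1 => i _; have [m [_ Mij]] := irrM i j.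
have [Mm0 _] := stochastic_exp m stM.
have /matrixP/(_ 0 j) := invariant_exp m piM; rewrite mxE pij0 => /eqP.
rewrite psumr_eq0; last by move=> l _; rewrite mulr_ge0.
by move=> /allP/(_ i (mem_index_enum _)) /=; rewrite mulf_eq0 (gt_eqF Mij) orbF => /eqP.
Qed.

Lemma wdot_eq0 pi g : (forall i, 0 < pi 0 i) -> wdot pi g g = 0 -> g = 0.
Proof.
move=> pi0 /eqP; rewrite psumr_eq0 => [|i _]; last first.
  by rewrite -mulrA mulr_ge0 ?(ltW (pi0 i))// -expr2 sqr_ge0.
move=> /allP gg; apply/matrixP => i j; rewrite ord1 mxE.
have := gg i (mem_index_enum _); rewrite -mulrA mulf_eq0 (gt_eqF (pi0 i)).
by rewrite mulf_eq0 orbb => /eqP.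
Qed.

End ReversibleForms.

(** * Real eigenvectors of an irreducible aperiodic matrix *)

Section ReversibleEigenvectors.
Variables (R : realType) (K : nat) (M : 'M[R]_K) (pi : 'rV[R]_K).
Hypotheses (stM : stochastic M) (irrM : irreducible M) (aperM : aperiodic M).
Hypotheses (invM : invariant_distribution M pi).
Implicit Types (g : 'cV[R]_K).

Let piM : pi *m M = pi. Proof. by case: invM. Qed.
Let pi_gt0 := invariant_gt0 irrM stM invM.

Lemma eigenvector_exp g (e : R) k : M *m g = e *: g -> M ^+ k *m g = e ^+ k *: g.
Proof.
move=> Mg; elim: k => [|k IH]; first by rewrite !expr0 mul1mx scale1r.
by rewrite mulmxS -mulmxA IH -scalemxAr Mg scalerA exprSr.
Qed.

(** The Dirichlet form of [g] for the matrix [M ^+ k] and the sign [e ^+ k] is zero. Its terms are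
    nonnegative, so each of them vanishes, and a positive entry then links [g i 0] to [g j 0]. *)
Lemma eigenvalue_sqr1 g (e : R) k i j : M *m g = e *: g -> e ^+ 2 = 1 ->
  0 < (M ^+ k) i j -> g i 0 = e ^+ k * g j 0.
Proof.
move=> Mg e2 Mij; have st := stochastic_exp k stM.
have e2k : (e ^+ k) ^+ 2 = 1 by rewrite exprAC e2 expr1n.
have := dirichlet_form g st (invariant_exp k piM) e2k.
rewrite (eigenvector_exp k Mg).
have -> : wdot pi g (e ^+ k *: g) = e ^+ k * wdot pi g g.
  by rewrite /wdot mulr_sumr; apply: eq_bigr => l _; rewrite mxE; ring.
rewrite mulrA -expr2 e2k mul1r subrr mulr0 => /eqP.
have nn l m : 0 <= pi 0 l * (M ^+ k) l m * (g l 0 - e ^+ k * g m 0) ^+ 2.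
  by rewrite mulr_ge0 ?sqr_ge0// mulr_ge0 ?(ltW (pi_gt0 l))//; case: st.
rewrite psumr_eq0 => [|l _]; last by apply: sumr_ge0.
move=> /allP/(_ i (mem_index_enum _)) /=.
rewrite psumr_eq0// => /allP/(_ j (mem_index_enum _)) /=.
rewrite mulf_eq0 sqrf_eq0 mulf_eq0 (gt_eqF (pi_gt0 i)) (gt_eqF Mij) /=.
by rewrite subr_eq0 => /eqP.
Qed.

Lemma eigenvalue1_const g i j : M *m g = g -> g i 0 = g j 0.
Proof.
move=> Mg; have [m [_ Mij]] := irrM i j.
by rewrite (@eigenvalue_sqr1 g 1 m i j) ?scale1r ?expr1n ?mul1r.
Qed.

(** At a state with [g i 0 != 0], every return time [m] satisfies [(-1) ^+ m = 1]. Then 2 is a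
    common divisor of the return times, against aperiodicity. *)
Lemma eigenvalueN1 g : M *m g = - g -> g = 0.
Proof.
move=> Mg; apply/matrixP => i j; rewrite ord1 mxE; apply/eqP/negPn/negP => gi.
suff : 2%N = 1%N by [].
apply: (aperM (i := i)) => m _ Mii.
have := @eigenvalue_sqr1 g (-1) m i i; rewrite scaleN1r sqrrN expr1n.
move=> /(_ Mg erefl Mii); rewrite -signr_odd dvdn2.
case: (odd m) => //=; rewrite expr1 mulN1r => /eqP.
by rewrite -subr_eq0 opprK -mulr2n mulrn_eq0 /= (negbTE gi).
Qed.

(** The Dirichlet form of [g] with sign [s] equals [2 * (1 - s * e) * wdot pi g g] and is
    nonnegative; the signs [1] and [-1] give the two inequalities. *)
Lemma eigenvalue_le1 g (e : R) : g != 0 -> M *m g = e *: g -> `|e| <= 1.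
Proof.
move=> g0 Mg.
have gg : 0 < wdot pi g g.
  rewrite lt0r; apply/andP; split.
    by apply: contra g0 => /eqP/(wdot_eq0 pi_gt0) ->.
  by rewrite sumr_ge0// => i _; rewrite -mulrA mulr_ge0 ?(ltW (pi_gt0 i))// -expr2 sqr_ge0.
have D (s : R) : s ^+ 2 = 1 -> 0 <= 1 - s * e.
  move=> s2; rewrite -(pmulr_lge0 _ gg).
  have := dirichlet_form g stM piM s2; rewrite Mg.
  have -> : wdot pi g (e *: g) = e * wdot pi g g.
    by rewrite /wdot mulr_sumr; apply: eq_bigr => l _; rewrite mxE; ring.
  rewrite mulrA -[X in X - _]mul1r -mulrBl => DE.
  rewrite -(@pmulr_rge0 _ 2)// -DE.
  apply: sumr_ge0 => i _; apply: sumr_ge0 => j _.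
  by rewrite mulr_ge0 ?sqr_ge0// mulr_ge0 ?(ltW (pi_gt0 i))//; case: stM.
rewrite ler_norml; have := D 1 (expr1n _ _); have := D (-1).
rewrite sqrrN expr1n mul1r mulN1r opprK => /(_ erefl); lra.
Qed.

Lemma eigenvalue_lt1 g (e : R) : g != 0 -> M *m g = e *: g -> e != 1 -> `|e| < 1.
Proof.
move=> g0 Mg e1; rewrite lt_neqAle (eigenvalue_le1 g0 Mg) andbT.
apply/negP => /eqP ae; have : e ^+ 2 = 1 by rewrite -real_normK ?num_real// ae expr1n.
move=> /eqP; rewrite sqrf_eq1 (negbTE e1) /= => /eqP eN.
by move: Mg; rewrite eN scaleN1r => /eigenvalueN1 /eqP; rewrite (negbTE g0).
Qed.

End ReversibleEigenvectors.

(** * Spectral gap *)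

Lemma char_poly_similar (F : fieldType) n (A B V : 'M[F]_n) :
  V \in unitmx -> V *m A = B *m V -> char_poly A = char_poly B.
Proof.
move=> uV VA.
have : map_mx polyC V *m char_poly_mx A = char_poly_mx B *m map_mx polyC V.
  by rewrite mulmxBr mulmxBl -!map_mxM VA scalar_mxC.
move/(congr1 determinant); rewrite !det_mulmx mulrC; apply: mulIf.
by rewrite det_map_mx polyC_eq0 -unitfE -unitmxE.
Qed.

Section SpectralGap.
Variables (R : realType) (K : nat) (M : 'M[R]_K) (pi : 'rV[R]_K).
Hypotheses (stM : stochastic M) (irrM : irreducible M) (aperM : aperiodic M).
Hypotheses (invM : invariant_distribution M pi) (revM : reversible M pi).

Let C := R[i].
Let sq i : R := Num.sqrt (pi 0 i).
Let D : 'M[C]_K := diag_mx (\row_i (sq i)%:C%C).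
Let MC : 'M[C]_K := map_mx (real_complex R) M.
(** This is the conjugate of [MC] by [D], which reversibility makes symmetric. Its entries are real,
    but it is taken over [C], where the spectral theorem and the list [eigenvalues] live. *)
Let SC : 'M[C]_K := \matrix_(i, j) (sq i * M i j / sq j)%:C%C.

Let piM : pi *m M = pi. Proof. by case: invM. Qed.
Let pi_gt0 := invariant_gt0 irrM stM invM.

Let sq_gt0 i : 0 < sq i. Proof. by rewrite sqrtr_gt0. Qed.
Let sq_neq0 i : sq i != 0. Proof. by rewrite gt_eqF. Qed.
Let sqE i : sq i * sq i = pi 0 i.
Proof. by rewrite -expr2 sqr_sqrtr// ltW. Qed.

Let SC_sym i j : SC i j = SC j i.
Proof.
rewrite !mxE; congr (_%:C)%C; apply/eqP.
by rewrite eqr_div// mulrAC sqE [X in _ == X]mulrAC sqE revM.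
Qed.

Let DMC : D *m MC = SC *m D.
Proof.
apply/matrixP => i j; rewrite mul_diag_mx mul_mx_diag !mxE -!rmorphM/=.
by rewrite divfK.
Qed.

Let DMCX k : D *m map_mx (real_complex R) (M ^+ k) = SC ^+ k *m D.
Proof.
elim: k => [|k IH]; first by rewrite !expr0 map_mx1 mulmx1 mul1mx.
by rewrite mulmxS map_mxM mulmxA DMC -mulmxA IH mulmxA -mulmxS.
Qed.

Let D_unit : D \in unitmx.
Proof.
rewrite unitmxE det_diag unitfE; apply/prodf_neq0 => i _.
by rewrite mxE fmorph_eq0.
Qed.

Section Eigenvector.
Variables (u : 'rV[C]_K) (e : R).
Hypothesis uS : u *m SC = (e%:C)%C *: u.

(** With [l] the real or the imaginary part, this turns a complex row eigenvector of [SC] into a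
    real column eigenvector of [M]; one of the two is nonzero. *)
Let part (l : C -> R) : 'cV[R]_K := \col_i (l (u 0 i) / sq i).

Let part_eigen (l : C -> R) : l 0 = 0 -> {morph l : x y / x + y} ->
  (forall a z, l ((a%:C)%C * z) = a * l z) -> M *m part l = e *: part l.
Proof.
move=> l0 lD lZ; apply/matrixP => i j; rewrite ord1 !mxE.
have /matrixP/(_ 0 i)/(congr1 l) := uS.
rewrite [X in l X = _]mxE [X in _ = l X]mxE lZ mulrA (big_morph l lD l0) => <-.
rewrite mulr_suml; apply: eq_bigr => m _; rewrite mxE.
rewrite SC_sym mxE [u 0 m * _]mulrC lZ.
by field; rewrite !sq_neq0.
Qed.

Let part_Re : M *m part (@complex.Re R) = e *: part (@complex.Re R).
Proof. by apply: part_eigen => // [[a b] [a' b']|a [b b']] //=; rewrite mul0r subr0. Qed.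

Let part_Im : M *m part (@complex.Im R) = e *: part (@complex.Im R).
Proof. by apply: part_eigen => // [[a b] [a' b']|a [b b']] //=; rewrite mul0r addr0. Qed.

Let part_neq0 : u != 0 -> (part (@complex.Re R) != 0) || (part (@complex.Im R) != 0).
Proof.
apply: contraNT; rewrite negb_or !negbK => /andP[/eqP/matrixP pR /eqP/matrixP pI].
apply/eqP/matrixP => i j; rewrite ord1 mxE.
move: (pR j 0) (pI j 0); rewrite !mxE => /eqP + /eqP.
rewrite !mulf_eq0 !invr_eq0 (negbTE (sq_neq0 j)) !orbF.
by case: (u 0 j) => a b /= /eqP -> /eqP ->.
Qed.

Lemma symmetrized_eigenvalue_lt1 : u != 0 -> e != 1 -> `|e| < 1.
Proof.
move=> /part_neq0/orP[p0|p0] e1.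
- exact: (eigenvalue_lt1 stM irrM aperM invM p0 part_Re e1).
- exact: (eigenvalue_lt1 stM irrM aperM invM p0 part_Im e1).
Qed.

Lemma symmetrized_eigenvector1 : e = 1 ->
  exists a : C, forall i, u 0 i = a * ((sq i)%:C)%C.
Proof.
(* The rescaled real and imaginary parts are constant in the state, so the factor [a] can be read
   off at any reference state [i0]. *)
move=> e1; have [i0 _|noi] := pickP (@predT 'I_K); last first.
  by exists 0 => i; have := noi i.
exists (Complex (complex.Re (u 0 i0) / sq i0) (complex.Im (u 0 i0) / sq i0)) => i.
have pR : M *m part (@complex.Re R) = part (@complex.Re R) by rewrite part_Re e1 scale1r.
have pI : M *m part (@complex.Im R) = part (@complex.Im R) by rewrite part_Im e1 scale1r.
have := eigenvalue1_const stM irrM invM i0 i pR.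
have := eigenvalue1_const stM irrM invM i0 i pI.
rewrite !mxE => -> ->; case: (u 0 i) => a b.
apply/eqP; rewrite eq_complex /= !mulr0 subr0 add0r.
by rewrite !divfK// !eqxx.
Qed.

End Eigenvector.

Let SC_herm : SC \is hermsymmx.
Proof.
apply/realsym_hermsym.
  apply/is_hermitianmxP; rewrite expr0 scale1r; apply/matrixP => i j.
  by rewrite [in RHS]mxE [in RHS]mxE SC_sym.
by apply/mxOverP => i j; rewrite mxE; apply/complex_realP; exists (sq i * M i j / sq j).
Qed.

Let U := spectralmx SC.
Let dd := spectral_diag SC.
Let ev r : R := complex.Re (dd 0 r).

Let ddE r : dd 0 r = ((ev r)%:C)%C.
Proof.
by rewrite /ev RRe_real//; have /mxOverP := hermitian_spectral_diag_real SC_herm; apply.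
Qed.

Let UU : U *m (U ^t* )%sesqui = 1%:M.
Proof. exact/unitarymxP/spectral_unitarymx. Qed.
Let UU' : (U ^t* )%sesqui *m U = 1%:M.
Proof. exact: mulmx1C UU. Qed.

Let SCE : SC = (U ^t* )%sesqui *m diag_mx dd *m U.
Proof.
rewrite -invmx_unitary; last exact: spectral_unitarymx.
exact/orthomx_spectralP/hermitian_normalmx.
Qed.

Let USC : U *m SC = diag_mx dd *m U.
Proof. by rewrite [in LHS]SCE !mulmxA UU mul1mx. Qed.

Let row_eigen r : row r U *m SC = ((ev r)%:C)%C *: row r U.
Proof.
by rewrite -row_mul USC; apply/matrixP => i j; rewrite mxE mul_diag_mx !mxE ddE.
Qed.

Let row_dot r s : \sum_i U r i * (U s i)^* = (r == s)%:R.
Proof.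
have /matrixP/(_ r s) := UU; rewrite !mxE => <-.
by apply: eq_bigr => i _; rewrite !mxE.
Qed.

Let row_neq0 r : row r U != 0.
Proof.
apply/eqP => /matrixP r0; have := row_dot r r; rewrite eqxx big1 => [/esym/eqP|i _].
  by rewrite oner_eq0.
by have := r0 0 i; rewrite !mxE => ->; rewrite mul0r.
Qed.

Let ev_neq1 r : ev r != 1 -> `|ev r| < 1.
Proof. exact: symmetrized_eigenvalue_lt1 (row_eigen r) (row_neq0 r). Qed.

Let row_ev1 r : ev r = 1 -> exists2 a : C, a != 0 & forall i, U r i = a * ((sq i)%:C)%C.
Proof.
move=> e1; have [a aE] := symmetrized_eigenvector1 (row_eigen r) e1.
exists a => [|i]; last by rewrite -aE mxE.
apply: contra (row_neq0 r) => /eqP a0; apply/eqP/matrixP => i j.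
by rewrite ord1 aE a0 mul0r mxE.
Qed.

(** Two rows for the eigenvalue 1 are nonzero multiples [a] and [b] of the vector of square roots of
    [pi]. Their inner product is [a] times the conjugate of [b], hence nonzero, whereas distinct
    rows of [U] are orthogonal. *)
Let ev1_uniq r s : ev r = 1 -> ev s = 1 -> r = s.
Proof.
move=> /row_ev1[a a0 aE] /row_ev1[b b0 bE]; apply/eqP/negPn/negP => rs.
have := row_dot r s; rewrite (negbTE rs).
under eq_bigr => i _.
  rewrite aE bE rmorphM/= [X in _ * (_ * X)](_ : _ = ((sq i)%:C)%C); last first.
    by apply/CrealP/complex_realP; exists (sq i).
  rewrite mulrACA -rmorphM/= sqE.
  over.
rewrite -mulr_sumr -rmorph_sum/=; case: invM => [[_ ->] _].
by move/eqP; rewrite mulr1 mulf_eq0 conjC_eq0 (negbTE a0) (negbTE b0).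
Qed.

(** The vector [v] of square roots of [pi] is fixed by [SC]. If no [ev r] were 1, all its
    coordinates in the eigenbasis would vanish. *)
Let ev1_ex : exists r, ev r = 1.
Proof.
apply: contrapT => /forallNP no1.
pose v : 'rV[C]_K := \row_i ((sq i)%:C)%C.
have vS : v *m SC = v.
  apply/matrixP => i j; rewrite ord1 !mxE.
  under eq_bigr => m _ do rewrite !mxE -rmorphM/= !mulrA sqE.
  rewrite -rmorph_sum/= -mulr_suml; have /matrixP/(_ 0 j) := piM; rewrite mxE => ->.
  by rewrite -sqE mulfK.
have cE : v *m (U ^t* )%sesqui *m diag_mx dd = v *m (U ^t* )%sesqui.
  by rewrite -{2}vS SCE !mulmxA -[_ *m U *m _]mulmxA UU mulmx1.
have c0 : v *m (U ^t* )%sesqui = 0.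
  apply/matrixP => i r; rewrite [RHS]mxE; have /matrixP/(_ i r) := cE.
  rewrite mul_mx_diag mxE => /eqP; rewrite -subr_eq0 -{2}[_ i r]mulr1 -mulrBr mulf_eq0.
  case/orP => [/eqP//|]; rewrite subr_eq0 ddE => /eqP/complexI/no1 [].
have v0 : v = 0 by rewrite -[v]mulmx1 -UU' mulmxA c0 mul0mx.
case: invM => [[_ p1] _]; move: p1; rewrite big1 => [/esym/eqP|i _].
  by rewrite oner_eq0.
by have /matrixP/(_ 0 i) := v0; rewrite !mxE => /complexI si; rewrite -sqE si mul0r.
Qed.

(** This links the roots of the characteristic polynomial, by which [second_abs_eigenvalue] is
    defined, with the spectral diagonal: [M], [SC] and [diag_mx dd] are similar. *)
Let eigenvalues_perm : perm_eq (eigenvalues M) [seq dd 0 r | r <- index_enum 'I_K].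
Proof.
apply: prod_XsubC_eq; rewrite big_map.
rewrite /eigenvalues; case: closed_field_poly_normal => s /= cp.
have -> : \prod_(z <- s) ('X - z%:P) = char_poly MC.
  by rewrite [RHS]cp (monicP (char_poly_monic _)) scale1r.
rewrite (char_poly_similar D_unit DMC).
rewrite (char_poly_similar (B := diag_mx dd) (V := U))//; last exact: spectral_unit.
rewrite char_poly_trig; last exact/diag_mx_is_trig.
by apply: eq_bigr => i _; rewrite mxE eqxx mulr1n.
Qed.

Let r0 := projT1 (cid ev1_ex).
Let ev_r0 : ev r0 = 1. Proof. exact: projT2 (cid ev1_ex). Qed.

Let ev_other r : r != r0 -> `|ev r| < 1.
Proof.
move=> rr0; apply: ev_neq1; apply: contra rr0 => /eqP er.
by apply/eqP; apply: ev1_uniq.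
Qed.

Let lambda := second_abs_eigenvalue M.

(** The decreasing list of moduli starts with the 1 contributed by [r0], so its entry of index 1 is
    the head of the sorted remainder. When the remainder is empty both default values are 0. *)
Let lambdaE : exists2 s : seq R,
  s =i [seq `|ev r| | r <- rem r0 (index_enum 'I_K)] &
  sorted >=%O s /\ lambda = head 0 s.
Proof.
pose s0 := [seq `|ev r| | r <- rem r0 (index_enum 'I_K)].
exists (sort >=%O s0); first by move=> z; rewrite mem_sort.
split; first by apply: sort_sorted => a b; exact: ge_total.
rewrite /lambda /second_abs_eigenvalue.
suff -> : sort >=%O [seq complex.Re `|z| | z <- eigenvalues M] = 1 :: sort >=%O s0.
  by rewrite /= nth0.
apply: (@sorted_eq _ >=%O).
- by move=> a b c; exact: ge_trans.
- by move=> a b; exact: ge_anti.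
- by apply: sort_sorted => a b; exact: ge_total.
- rewrite /= path_sortedE; last by move=> a b c; exact: ge_trans.
  rewrite sort_sorted ?andbT; last by move=> a b; exact: ge_total.
  apply/allP => z; rewrite mem_sort => /mapP[r]; rewrite mem_rem_uniq ?index_enum_uniq//.
  by rewrite inE => /andP[rr0 _] ->; exact/ltW/ev_other.
- rewrite perm_sort; apply: perm_trans (perm_map _ eigenvalues_perm) _.
  rewrite -map_comp perm_sym -[1]normr1 -ev_r0.
  apply: (perm_trans (y := `|ev r0| :: s0)).
    by rewrite perm_cons perm_sort.
  rewrite /s0 -[_ :: _]/(map (fun r => `|ev r|) (r0 :: _)).
  have -> : [seq ((fun z : C => complex.Re `|z|) \o dd 0) r | r <- index_enum 'I_K]
      = [seq `|ev r| | r <- index_enum 'I_K].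
    by apply: eq_map => r; rewrite [LHS]/= ddE /= expr0n addr0 sqrtr_sqr.
  by rewrite perm_map// perm_sym perm_to_rem// mem_index_enum.
Qed.

Lemma second_abs_eigenvalue_ge0 : 0 <= lambda.
Proof.
have [[|z s] sE [_ ->]] //= := lambdaE.
by have := mem_head z s; rewrite sE => /mapP[r _ ->].
Qed.

Lemma second_abs_eigenvalue_lt1 : lambda < 1.
Proof.
have [[|z s] sE [_ ->]] /= := lambdaE; first exact: ltr01.
have := mem_head z s; rewrite sE => /mapP[r]; rewrite mem_rem_uniq ?index_enum_uniq//.
by rewrite inE => /andP[rr0 _] ->; rewrite ev_other.
Qed.

Let ev_le r : r != r0 -> `|ev r| <= lambda.
Proof.
move=> rr0; have [s sE [ss ->]] := lambdaE.
have : `|ev r| \in s.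
  rewrite sE; apply/mapP; exists r => //.
  by rewrite mem_rem_uniq ?index_enum_uniq// inE rr0 mem_index_enum.
case: s ss {sE} => //= z s; rewrite path_sortedE => [/andP[/allP zs _]|a b c]; last exact: ge_trans.
by rewrite inE => /orP[/eqP ->//|/zs].
Qed.

(* The vector [D g] is expanded in the orthonormal eigenbasis [U] of the
   symmetrized matrix; its coordinate [r0] vanishes because that eigenvector is
   proportional to [sqrt pi]. *)
Lemma wdot_exp_le (g : 'cV[R]_K) k : \sum_i pi 0 i * g i 0 = 0 ->
  wdot pi g (M ^+ k *m g) <= lambda ^+ k * wdot pi g g.
Proof.
move=> pig.
pose gC : 'cV[C]_K := map_mx (real_complex R) g.
pose h : 'rV[C]_K := \row_i ((sq i * g i 0)%:C)%C.
pose c : 'rV[C]_K := h *m (U ^t* )%sesqui.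
have hT : h^T = D *m gC.
  by apply/matrixP => i j; rewrite ord1 mul_diag_mx !mxE -rmorphM.
have UhT : U *m h^T = ((c ^ Num.conj)%sesqui)^T.
  apply/matrixP => r j; rewrite ord1 !mxE rmorph_sum; apply: eq_bigr => i _.
  rewrite !mxE [RHS]rmorphM /= conjCK mulrC; congr (_ * _).
  by apply/esym/CrealP/complex_realP; exists (sq i * g i 0).
have hSk m : h *m SC ^+ m = c *m diag_mx (\row_r (dd 0 r ^+ m)) *m U.
  elim: m => [|m IH].
    rewrite expr0 mulmx1 (_ : diag_mx _ = 1%:M) ?mulmx1 -?mulmxA ?UU' ?mulmx1//.
    by apply/matrixP => i j; rewrite !mxE expr0.
  rewrite exprSr -[SC ^+ m * SC]/(SC ^+ m *m SC) mulmxA IH -!mulmxA USC; congr (_ *m _).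
  rewrite !mulmxA; congr (_ *m _); rewrite -mulmxA; congr (_ *m _); apply/matrixP => i j.
  rewrite mul_diag_mx !mxE exprSr.
  by case: eqP => [->|]; rewrite ?mulr1n// !mulr0n mulr0.
(* Both sides are [h *m SC ^+ m *m h^T]: conjugation by [D] gives the left-hand side,
   diagonalization by [U] the right-hand side. *)
have norm2 m : wdot pi g (M ^+ m *m g)
    = \sum_r ev r ^+ m * (complex.Re (c 0 r) ^+ 2 + complex.Im (c 0 r) ^+ 2).
  apply: complexI; transitivity ((h *m SC ^+ m *m h^T) 0 0).
    rewrite hT -[h *m _ *m _]mulmxA [SC ^+ m *m (D *m _)]mulmxA -DMCX -[D *m _ *m _]mulmxA.
    rewrite -map_mxM [h *m _]mulmxA mxE rmorph_sum /=.
    apply: eq_bigr => i _; rewrite mul_mx_diag !mxE -!rmorphM/=; congr (_%:C)%C.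
    by rewrite -sqE; ring.
  rewrite hSk -[_ *m U *m _]mulmxA UhT mul_mx_diag mxE rmorph_sum /=.
  apply: eq_bigr => r _; rewrite mxE mxE rmorphM /= add_Re2_Im2 normCK ddE mxE rmorphXn /=.
  by rewrite [_ * (_ ^+ m)]mulrC -mulrA; congr (_ * (_ * _)); rewrite !mxE.
have c0 : c 0 r0 = 0.
  have [a _ aE] := row_ev1 ev_r0.
  rewrite mxE; under eq_bigr => i _.
    rewrite !mxE aE [(_ * _)^*]rmorphM /= [X in _ * (_ * X)](_ : _ = ((sq i)%:C)%C); last first.
      by apply/CrealP/complex_realP; exists (sq i).
    rewrite mulrCA -rmorphM /= mulrAC sqE.
    over.
  by rewrite -mulr_sumr -rmorph_sum/= pig mulr0.
have := norm2 0%N; rewrite expr0 mul1mx => ->; rewrite norm2 mulr_sumr.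
apply: ler_sum => r _; have [->|rr0] := eqVneq r r0.
  by rewrite c0 /= expr0n/= addr0 !mulr0.
rewrite expr0 mul1r ler_wpM2r ?addr_ge0 ?sqr_ge0//.
rewrite (le_trans (ler_norm _))// normrX lerXn2r ?nnegrE ?ev_le//.
exact: second_abs_eigenvalue_ge0.
Qed.

End SpectralGap.

(** * Occupation variance *)

Section OccupationVariance.
Variables (R : realType) (K : nat) (M : 'M[R]_K) (pi : 'rV[R]_K).
Hypotheses (stM : stochastic M) (irrM : irreducible M) (aperM : aperiodic M).
Hypotheses (invM : invariant_distribution M pi) (revM : reversible M pi).
Implicit Types (g h : 'cV[R]_K).

Let lambda := second_abs_eigenvalue M.

(* The vector of the expectations of [g (X s) * g (X t)], indexed by the initial
   state of the chain. *)
Definition two_point g (s t : nat) : 'cV[R]_K :=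
  M ^+ minn s t *m \col_i (g i 0 * (M ^+ ((s - t) + (t - s))%N *m g) i 0).

(** The expected square of the sum of [g (X t)] over [t < n], indexed by the initial state. *)
Definition second_moment g n : 'cV[R]_K := \sum_(s < n) \sum_(t < n) two_point g s t.

(** First-step analysis: the square splits into that of the term at time 0, twice its product with
    the remaining sum, and the square of the remaining sum, which is the same quantity restarted
    after one step. *)
Lemma second_moment_recl g n : second_moment g n.+1 =
  (\col_i (g i 0 ^+ 2 + 2 * (g i 0 * (M *m \sum_(t < n) M ^+ t *m g) i 0)))
  + M *m second_moment g n.
Proof.
have S s t : two_point g s.+1 t.+1 = M *m two_point g s t.
  by rewrite /two_point minnSS !subSS mulmxS mulmxA.
have E0 : two_point g 0 0 = \col_i (g i 0 ^+ 2).
  by rewrite /two_point minnn subnn expr0 !mul1mx.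
have EM k : M ^+ k.+1 *m g = M *m (M ^+ k *m g) by rewrite mulmxS mulmxA.
have E1 t : two_point g 0 t.+1 = \col_i (g i 0 * (M *m (M ^+ t *m g)) i 0).
  by rewrite /two_point min0n sub0n add0n subn0 expr0 mul1mx EM.
have E2 t : two_point g t.+1 0 = \col_i (g i 0 * (M *m (M ^+ t *m g)) i 0).
  by rewrite /two_point minn0 sub0n addn0 subn0 expr0 mul1mx EM.
have E3 : \sum_(t < n) \col_i (g i 0 * (M *m (M ^+ t *m g)) i 0)
    = \col_i (g i 0 * (M *m \sum_(t < n) M ^+ t *m g) i 0).
  apply/matrixP => i j; rewrite summxE mxE mulmx_sumr summxE mulr_sumr.
  by apply: eq_bigr => t _; rewrite mxE.
rewrite /second_moment big_ord_recl big_ord_recl E0.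
under eq_bigr => t _ do rewrite E1.
under [X in _ + _ + X]eq_bigr => s _.
  rewrite big_ord_recl E2; under eq_bigr => t _ do rewrite S.
  rewrite -mulmx_sumr; over.
rewrite big_split/= E3 addrA; congr (_ + _).
  by apply/matrixP => i j; rewrite !mxE; ring.
by rewrite mulmx_sumr.
Qed.

(** The difference of the two sides is the variance of [h] under row [i] of [M]. *)
Lemma jensen_stochastic h i : (M *m h) i 0 ^+ 2 <= (M *m (\col_j h j 0 ^+ 2)) i 0.
Proof.
have [M0 M1] := stM.
set m := (M *m h) i 0.
have : 0 <= \sum_j M i j * (h j 0 - m) ^+ 2.
  by apply: sumr_ge0 => j _; rewrite mulr_ge0// sqr_ge0.
suff -> : \sum_j M i j * (h j 0 - m) ^+ 2 = (M *m (\col_j h j 0 ^+ 2)) i 0 - m ^+ 2.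
  by rewrite subr_ge0.
transitivity ((M *m (\col_j h j 0 ^+ 2)) i 0 - 2 * m * (M *m h) i 0 + m ^+ 2 * \sum_j M i j).
  rewrite ![(_ *m _) i 0]mxE !mulr_sumr -sumrB -big_split/=.
  by apply: eq_bigr => j _; rewrite mxE; ring.
by rewrite M1 -/m; ring.
Qed.

(** The left-hand side is the squared expectation of the sum. The purpose is the nonnegativity of
    [second_moment] at each initial state, which its summands do not show since they have no
    sign. *)
Lemma second_moment_ge g n i :
  (\sum_(t < n) M ^+ t *m g) i 0 ^+ 2 <= second_moment g n i 0.
Proof.
elim: n i => [|n IH] i.
  by rewrite /second_moment !big_ord0 !mxE expr0n.
rewrite second_moment_recl big_ord_recl expr0 mul1mx.
set v := \sum_(t < n) M ^+ t *m g.
have -> : \sum_(t < n) M ^+ bump 0 t *m g = M *m v.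
  by rewrite mulmx_sumr; apply: eq_bigr => t _; rewrite mulmxS mulmxA.
rewrite [X in X ^+ 2]mxE [leRHS]mxE sqrrD -[_ * _ *+ 2]mulr_natl.
rewrite [X in _ <= X + _]mxE -!addrA !lerD2l.
apply: (le_trans (jensen_stochastic v i)).
rewrite [X in X <= _]mxE [X in _ <= X]mxE; apply: ler_sum => j _.
by rewrite mxE ler_wpM2l ?IH//; case: stM.
Qed.

Lemma second_moment_ge0 g n i : 0 <= second_moment g n i 0.
Proof. exact: le_trans (sqr_ge0 _) (second_moment_ge g n i). Qed.

Lemma sum_geometric_le (x : R) n : 0 <= x -> x < 1 -> \sum_(k < n) x ^+ k <= (1 - x)^-1.
Proof.
move=> x0 x1; rewrite -[leRHS]mul1r ler_pdivlMr ?subr_gt0// mulrC.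
have -> : (1 - x) * \sum_(k < n) x ^+ k = 1 - x ^+ n.
  have := subrX1 x n; move=> /(congr1 -%R); rewrite opprB => ->.
  by rewrite -mulNr opprB.
by rewrite lerBlDr lerDl exprn_ge0.
Qed.

(** For fixed [s] the terms with [t < s] and those with [s <= t] each form a geometric sum, whence
    the factor 2. The first sum, read backwards, has exponents [k.+1], because the diagonal term
    belongs to the second. *)
Lemma sum_geometric_dist_le (x : R) n : 0 <= x -> x < 1 ->
  \sum_(s < n) \sum_(t < n) x ^+ ((s - t) + (t - s))%N <= 2 * n%:R * (1 - x)^-1.
Proof.
move=> x0 x1; rewrite mulrAC mulr_natr -[n in X in _ <= X]card_ord -sumr_const.
apply: ler_sum => s _; rewrite mulr2n mulrDl mul1r.
rewrite -(big_mkord xpredT (fun t => x ^+ ((s - t) + (t - s))%N)).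
rewrite (big_cat_nat (n := s))//=; last exact: ltnW.
apply: lerD.
  rewrite big_nat_rev/= add0n big_mkord.
  apply: le_trans (sum_geometric_le s x0 x1); apply: ler_sum => k _.
  rewrite (_ : (_ + _)%N = k.+1); last by have := ltn_ord k; lia.
  by rewrite exprS ler_piMl ?exprn_ge0// ltW.
rewrite -{1}[nat_of_ord s]add0n big_addn big_mkord.
apply: le_trans (sum_geometric_le (n - s) x0 x1); apply: ler_sum => k _.
by have -> : (s - (k + s) + (k + s - s) = k)%N by lia.
Qed.

Lemma stationary_two_point g s t :
  (pi *m two_point g s t) 0 0 = wdot pi g (M ^+ ((s - t) + (t - s))%N *m g).
Proof.
case: invM => _ piM.
rewrite /two_point mulmxA (invariant_exp _ piM) mxE.
by apply: eq_bigr => i _; rewrite mxE mulrA.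
Qed.

Lemma stationary_second_moment_le g n : \sum_i pi 0 i * g i 0 = 0 ->
  (pi *m second_moment g n) 0 0 <= 2 * n%:R * (1 - lambda)^-1 * wdot pi g g.
Proof.
move=> pig; have gg : 0 <= wdot pi g g.
  apply: sumr_ge0 => i _; rewrite -mulrA mulr_ge0 -?expr2 ?sqr_ge0//.
  by case: invM => [[]].
apply: (@le_trans _ _ ((\sum_(s < n) \sum_(t < n) lambda ^+ ((s - t) + (t - s))%N) * wdot pi g g)).
  rewrite mulmx_sumr summxE mulr_suml; apply: ler_sum => s _.
  rewrite mulmx_sumr summxE mulr_suml; apply: ler_sum => t _.
  by rewrite stationary_two_point wdot_exp_le.
rewrite ler_wpM2r// sum_geometric_dist_le//.
- exact: second_abs_eigenvalue_ge0 stM irrM aperM invM revM.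
- exact: second_abs_eigenvalue_lt1 stM irrM aperM invM revM.
Qed.

Lemma max_ratio_ge (u v : 'rV[R]_K) i : u 0 i / v 0 i <= max_ratio u v.
Proof. by rewrite /max_ratio le_bigmax. Qed.

Lemma max_ratio_ge0 (u v : 'rV[R]_K) : 0 <= max_ratio u v.
Proof. exact: bigmax_ge_id. Qed.

Lemma max_ratio_ge1 (u v : 'rV[R]_K) : distribution_vector u ->
  distribution_vector v -> (forall i, 0 < v 0 i) -> 1 <= max_ratio u v.
Proof.
move=> [_ u1] [_ v1] v0; rewrite -u1 -[leRHS]mulr1 -v1 mulr_sumr.
by apply: ler_sum => i _; rewrite -ler_pdivrMr ?max_ratio_ge.
Qed.

(** The vector [g] is the indicator of [j], centered under [pi]. Since [mu] is at most
    [max_ratio mu pi] times [pi] and [second_moment] is nonnegative, the bound reduces to the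
    stationary one, where [wdot pi g g] is the Bernoulli variance. *)
Lemma occupation_variance_le (mu : 'rV[R]_K) n j :
  (mu *m second_moment (\col_i ((i == j)%:R - pi 0 j)) n) 0 0
    <= 4 * (max_ratio mu pi * (1 - lambda ^+ 2)^-1) * (n%:R * pi 0 j).
Proof.
set g := \col_i _.
have l0 : 0 <= lambda by exact: second_abs_eigenvalue_ge0 stM irrM aperM invM revM.
have l1 : lambda < 1 by exact: second_abs_eigenvalue_lt1 stM irrM aperM invM revM.
have [[pi0 pi1] _] := invM.
have pi_gt0 := invariant_gt0 irrM stM invM.
have pij : \sum_i pi 0 i * (i == j)%:R = pi 0 j.
  rewrite (bigD1 j)//= eqxx mulr1 big1 ?addr0// => i /negbTE ->.
  by rewrite mulr0.
have pig : \sum_i pi 0 i * g i 0 = 0.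
  under eq_bigr do rewrite mxE mulrBr.
  by rewrite sumrB pij -mulr_suml pi1 mul1r subrr.
have gg : wdot pi g g <= pi 0 j.
  have -> : wdot pi g g = pi 0 j - pi 0 j ^+ 2.
    transitivity (\sum_i (pi 0 i * (i == j)%:R - pi 0 j * (pi 0 i * (i == j)%:R)
        - pi 0 j * (pi 0 i * g i 0))).
      apply: eq_bigr => i _; rewrite mxE.
      by case: (i == j) => /=; ring.
    by rewrite !sumrB -!mulr_sumr pig pij; ring.
  by rewrite gerBl sqr_ge0.
apply: (@le_trans _ _ (max_ratio mu pi * (pi *m second_moment g n) 0 0)).
  rewrite !mxE mulr_sumr; apply: ler_sum => i _.
  by rewrite mulrA ler_wpM2r ?second_moment_ge0// -ler_pdivrMr// max_ratio_ge.
rewrite [leRHS](_ : _ = max_ratio mu pi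
  * (4 * (1 - lambda ^+ 2)^-1 * (n%:R * pi 0 j))); last by ring.
rewrite ler_wpM2l ?max_ratio_ge0//.
apply: (le_trans (stationary_second_moment_le n pig)).
apply: (@le_trans _ _ (2 * n%:R * (1 - lambda)^-1 * pi 0 j)).
  by rewrite ler_wpM2l// !mulr_ge0// invr_ge0 subr_ge0 ltW.
(* The factor [1 + lambda] is at most 2, which turns the constant 2 of the stationary bound into
   4. *)
have -> : (1 - lambda)^-1 = (1 + lambda) * (1 - lambda ^+ 2)^-1.
  by field; rewrite !gt_eqF//; nra.
have a0 : 0 <= (1 - lambda ^+ 2)^-1 by rewrite invr_ge0; nra.
have : 0 <= n%:R * pi 0 j * (1 - lambda ^+ 2)^-1 by rewrite !mulr_ge0.
set a := _^-1 => H; nra.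
Qed.

End OccupationVariance.

(** * Orthogonality to a sigma-algebra *)

Section IntegrableReal.
Context {d : measure_display} {Omega : measurableType d} {R : realType}.
Variable Pr : probability Omega R.
Implicit Types (f g h w phi : Omega -> R) (A B E : set Omega).

Definition integrableR f : Prop := Pr.-integrable setT (EFin \o f).

Lemma integrableR_measurable f : integrableR f -> measurable_fun setT f.
Proof. by move=> /measurable_int/measurable_EFinP. Qed.

Lemma integrableR_le f g : measurable_fun setT f -> integrableR g ->
  (forall x, `|f x| <= `|g x|) -> integrableR f.
Proof.
move=> mf ig fg; apply: le_integrable ig => //; first exact/measurable_EFinP.
by move=> x _ /=; rewrite lee_fin.
Qed.

Lemma integrableRD f g : integrableR f -> integrableR g ->
  integrableR (fun x => f x + g x).
Proof. by move=> fi gi; apply: eq_integrable (integrableD measurableT fi gi). Qed.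

Lemma integrableRB f g : integrableR f -> integrableR g ->
  integrableR (fun x => f x - g x).
Proof. by move=> fi gi; apply: eq_integrable (integrableB measurableT fi gi). Qed.

Lemma integrableRMl h f (c : R) : measurable_fun setT h ->
  (forall x, `|h x| <= c) -> integrableR f -> integrableR (fun x => h x * f x).
Proof.
move=> mh hc fi.
apply: (@integrableR_le _ (fun x => c * f x)).
- exact: measurable_funM mh (integrableR_measurable fi).
- by apply: eq_integrable (integrableZl measurableT c fi).
- by move=> x; rewrite !normrM ler_wpM2r// (le_trans (hc x))// ler_norm.
Qed.

Lemma integrableR_cst (c : R) : integrableR (fun=> c).
Proof. exact: finite_measure_integrable_cst. Qed.

Lemma integrableR_bounded h (c : R) : measurable_fun setT h ->
  (forall x, `|h x| <= c) -> integrableR h.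
Proof.
move=> mh hc; have := integrableRMl mh hc (integrableR_cst 1).
by apply: eq_integrable => // x _ /=; rewrite mulr1.
Qed.

Lemma normr_indic_le1 A (x : Omega) : `|\1_A x : R| <= 1.
Proof. by rewrite indicE; case: (x \in A); rewrite ?normr1 ?normr0. Qed.

Lemma integrableR_indicM A f : measurable A -> integrableR f ->
  integrableR (fun x => \1_A x * f x).
Proof. by move=> mA; apply: integrableRMl (normr_indic_le1 A). Qed.

Lemma indicM A B (x : Omega) : \1_A x * \1_B x = \1_(A `&` B) x :> R.
Proof. by rewrite !indicE in_setI; case: (x \in A); case: (x \in B); rewrite /= ?mulr1 ?mulr0. Qed.

Lemma integral_setEindic A f :
  (\int[Pr]_(x in A) (f x)%:E = \int[Pr]_x (\1_A x * f x)%:E)%E.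
Proof.
rewrite integral_mkcond; apply: eq_integral => x _.
by rewrite patchE indicE; case: (x \in A); rewrite ?mul1r ?mul0r.
Qed.

Lemma integralRD f g : integrableR f -> integrableR g ->
  (\int[Pr]_x (f x + g x)%:E = \int[Pr]_x (f x)%:E + \int[Pr]_x (g x)%:E)%E.
Proof. by move=> fi gi; rewrite -integralD. Qed.

Lemma integralRB f g : integrableR f -> integrableR g ->
  (\int[Pr]_x (f x - g x)%:E = \int[Pr]_x (f x)%:E - \int[Pr]_x (g x)%:E)%E.
Proof. by move=> fi gi; rewrite -integralB. Qed.

Lemma integralRZ (c : R) f : integrableR f ->
  (\int[Pr]_x (c * f x)%:E = c%:E * \int[Pr]_x (f x)%:E)%E.
Proof. by move=> fi; rewrite -integralZl. Qed.

Lemma integralR_sum (I : Type) (s : seq I) (P : pred I) (F : I -> Omega -> R) :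
  (forall i, integrableR (F i)) ->
  (\int[Pr]_x (\sum_(i <- s | P i) F i x)%:E
    = \sum_(i <- s | P i) \int[Pr]_x (F i x)%:E)%E.
Proof.
move=> Fi; rewrite -integral_sum//.
by apply: eq_integral => x _; rewrite sumEFin.
Qed.

Lemma integrableR_sum (I : Type) (s : seq I) (P : pred I) (F : I -> Omega -> R) :
  (forall i, integrableR (F i)) -> integrableR (fun x => \sum_(i <- s | P i) F i x).
Proof.
move=> Fi; have := @integrable_sum _ _ _ Pr _ measurableT _ s P _ (fun i _ => Fi i).
by apply: eq_integrable => // x _; rewrite /= sumEFin.
Qed.

Section VanishingOnPreimages.
Import HBNNSimple.
Variables (w phi : Omega -> R).
Hypotheses (iw : integrableR w) (mphi : measurable_fun setT phi).
Hypothesis w0 : forall S : set R, measurable S ->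
  (\int[Pr]_x (\1_(phi @^-1` S) x * w x)%:E = 0)%E.

Let mpre (S : set R) : measurable S -> measurable (phi @^-1` S).
Proof. by move=> mS; rewrite -[X in measurable X]setTI; exact: mphi. Qed.

Let vanish_nnsfun (q : {nnsfun R >-> R}) :
  (\int[Pr]_x (q (phi x) * w x)%:E = 0)%E.
Proof.
under eq_integral => x _.
  rewrite fimfunE fsbig_finite//= mulr_suml.
  under eq_bigr => y _ do rewrite -mulrA.
  over.
have iq y : integrableR (fun x => y * (\1_(q @^-1` [set y]) (phi x) * w x)).
  have i1 : integrableR (fun x => \1_(phi @^-1` (q @^-1` [set y])) x * w x).
    exact/integrableR_indicM/iw/mpre.
  by apply: eq_integrable (integrableZl measurableT y i1).
rewrite integralR_sum//= big1// => y _.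
rewrite integralRZ; last exact/integrableR_indicM/iw/mpre.
by rewrite (w0 (S := q @^-1` [set y])) ?mule0.
Qed.

(** As [w] has no sign, the simple approximations of [p] are passed to the limit by dominated
    convergence, with majorant the absolute value of [phi * w]. *)
Let vanish_dominated (p : R -> R) : measurable_fun setT p ->
  (forall z, 0 <= p z <= `|z|) -> integrableR (fun x => phi x * w x) ->
  (\int[Pr]_x (p (phi x) * w x)%:E = 0)%E.
Proof.
move=> mp p_le ipw.
have mpE : measurable_fun setT (EFin \o p) by exact/measurable_EFinP.
pose q := nnsfun_approx measurableT mpE.
have q_cvg z : EFin \o q ^~ z @ \oo --> (p z)%:E.
  by apply: (cvg_nnsfun_approx measurableT mpE) => // y _; rewrite lee_fin; case/andP: (p_le y).
have q_le n z : q n z <= p z.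
  have nd : {homo (EFin \o q ^~ z) : m k / (m <= k)%N >-> (m <= k)%E}.
    by move=> m k mk; rewrite lee_fin; exact/lefP/nd_nnsfun_approx.
  rewrite -lee_fin (cvg_unique _ (q_cvg z) (ereal_nondecreasing_cvgn nd))//.
  by apply: ereal_sup_ubound; exists n.
have mw := integrableR_measurable iw.
have [] := @dominated_convergence _ _ _ Pr setT measurableT
  (fun n x => (q n (phi x) * w x)%:E) (fun x => (p (phi x) * w x)%:E)
  (fun x => `|(phi x * w x)%:E|%E).
- move=> n; apply/measurable_EFinP; apply: measurable_funM => //.
  exact: measurableT_comp.
- by apply/measurable_EFinP; apply: measurable_funM => //; exact: measurableT_comp.
- apply: aeW => x _.
  have -> : (fun n => (q n (phi x) * w x)%:E) = (fun n => (q n (phi x))%:E * (w x)%:E)%E.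
    by apply/funext => n; rewrite EFinM.
  by rewrite EFinM; apply: cvgeZr => //; exact: q_cvg.
- exact: (integrable_abse ipw).
- apply: aeW => x n _; rewrite lee_fin !normrM ler_wpM2r// ger0_norm//.
  by rewrite (le_trans (q_le _ _))//; case/andP: (p_le (phi x)).
move=> _ _; under eq_fun do rewrite vanish_nnsfun.
by move=> /(@cvg_lim _ _ _)<-//; rewrite lim_cst.
Qed.

(** The hypothesis [w0] is the claim for indicators of preimages. It extends to simple functions of
    [phi] by linearity, then to the positive and negative parts of [phi] by dominated convergence.
    All later passages from events to random variables go through this lemma. *)
Lemma integral_vanish_comp : integrableR (fun x => phi x * w x) ->
  (\int[Pr]_x (phi x * w x)%:E = 0)%E.
Proof.
move=> ipw.
have mM : measurable_fun setT (fun z : R => Num.max z 0).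
  by apply: measurable_funrpos.
have mN : measurable_fun setT (fun z : R => Num.max (- z) 0).
  by apply: measurable_funrneg.
have mw := integrableR_measurable iw.
have bM (z : R) : 0 <= Num.max z 0 <= `|z| by rewrite le_max lexx orbT ge_max ler_norm normr_ge0.
have bN (z : R) : 0 <= Num.max (- z) 0 <= `|z|.
  by rewrite le_max lexx orbT ge_max -normrN ler_norm normr_ge0.
have i (p : R -> R) : measurable_fun setT p -> (forall z, 0 <= p z <= `|z|) ->
    integrableR (fun x => p (phi x) * w x).
  move=> mp p_le; apply: integrableR_le ipw _.
    by apply: measurable_funM => //; exact: measurableT_comp.
  move=> x; rewrite !normrM ler_wpM2r//; have /andP[p0] := p_le (phi x).
  by rewrite ger0_norm.
transitivity (\int[Pr]_x (Num.max (phi x) 0 * w x - Num.max (- phi x) 0 * w x)%:E)%E.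
  apply: eq_integral => x _; rewrite -mulrBl; congr (_ * _)%:E.
  have [p0|/ltW p0] := leP 0 (phi x).
    by rewrite [X in _ - X]max_r ?oppr_le0// subr0.
  by rewrite [X in _ - X]max_l ?oppr_ge0// sub0r opprK.
rewrite integralRB; [|exact: i mM bM|exact: i mN bN].
by rewrite (vanish_dominated mM bM ipw) (vanish_dominated mN bN ipw) subee.
Qed.

End VanishingOnPreimages.

End IntegrableReal.

(** * Functions with vanishing conditional expectation *)

Section OrthogonalToSigmaAlgebra.
Context {d : measure_display} {Omega : measurableType d} {R : realType}.
Variables (Pr : probability Omega R) (G : set (set Omega)).
Hypothesis GI : forall A B, G A -> G B -> G (A `&` B).
Hypothesis Gm : forall A, G A -> measurable A.
Implicit Types (f g h w phi : Omega -> R) (A B E : set Omega).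

(** For integrable [w] this says that the conditional expectation of [w] given [G] is zero, without
    choosing a version of it. *)
Definition orth w : Prop :=
  forall A, G A -> (\int[Pr]_x (\1_A x * w x)%:E = 0)%E.

(** Measurability with respect to [G], phrased for a bare set system so that several of them can
    coexist on [Omega]. *)
Definition preimages_in phi : Prop :=
  forall S : set R, measurable S -> G (phi @^-1` S).

Lemma preimages_in_measurable phi : preimages_in phi -> measurable_fun setT phi.
Proof. by move=> Gphi _ S mS; rewrite setTI; exact/Gm/Gphi. Qed.

Lemma preimages_in_comp (p : R -> R) phi : measurable_fun setT p ->
  preimages_in phi -> preimages_in (p \o phi).
Proof.
move=> mp Gphi S mS; rewrite comp_preimage; apply: Gphi.
by rewrite -[X in measurable X]setTI; exact: mp.
Qed.

Lemma orthB w1 w2 : integrableR Pr w1 -> integrableR Pr w2 ->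
  orth w1 -> orth w2 -> orth (fun x => w1 x - w2 x).
Proof.
move=> i1 i2 o1 o2 A GA.
under eq_integral do rewrite mulrBr.
by rewrite integralRB ?o1 ?o2 ?sube0//; apply: integrableR_indicM => //; exact: Gm.
Qed.

Lemma orth_ae_eq w1 w2 : measurable_fun setT w1 -> measurable_fun setT w2 ->
  {ae Pr, forall x, w1 x = w2 x} -> orth w1 -> orth w2.
Proof.
move=> m1 m2 w12 o1 A GA; rewrite -[RHS](o1 A GA); apply: ae_eq_integral => //.
- by apply/measurable_EFinP/measurable_funM => //; exact/measurable_indic/Gm.
- by apply/measurable_EFinP/measurable_funM => //; exact/measurable_indic/Gm.
- by apply: filterS w12 => x wx _; rewrite wx.
Qed.

(** A factor measurable for [G] can be taken out of the conditional expectation. For an indicator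
    factor this is the stability of [G] under intersection. *)
Lemma orth_mul w phi : integrableR Pr w -> preimages_in phi ->
  integrableR Pr (fun x => phi x * w x) -> orth w -> orth (fun x => phi x * w x).
Proof.
move=> iw Gphi ipw ow A GA.
under eq_integral do rewrite mulrCA.
apply: (@integral_vanish_comp _ _ _ Pr (fun x => \1_A x * w x) phi).
- exact/integrableR_indicM/iw/Gm.
- exact: preimages_in_measurable.
- move=> S mS; under eq_integral do rewrite mulrA indicM.
  by apply: ow; apply: GI => //; exact: Gphi.
- under eq_fun do rewrite mulrCA.
  exact/integrableR_indicM/ipw/Gm.
Qed.

Lemma cond_expectation_orth f g : is_cond_expectation Pr G f g ->
  [/\ integrableR Pr f, integrableR Pr g, preimages_in g & orth (fun x => g x - f x)].
Proof.
move=> [fi gi Gg fg]; split => // A GA.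
under eq_integral do rewrite mulrBr.
have mA := Gm GA.
rewrite integralRB; [|exact: integrableR_indicM|exact: integrableR_indicM].
rewrite -!integral_setEindic fg// subee// integrable_fin_num//.
by apply: integrableS fi.
Qed.

(* A version of the conditional probability of [E] takes its values in [0, 1]
   up to a null set, so that truncating it gives another version. *)
Definition clamp01 (z : R) : R := Num.max 0 (Num.min 1 z).

Lemma clamp01_itv z : 0 <= clamp01 z <= 1.
Proof. by rewrite /clamp01 le_max lexx ge_max ler01 ge_min lexx. Qed.

Lemma clamp01_norm z : `|clamp01 z| <= 1.
Proof. by have /andP[z0 z1] := clamp01_itv z; rewrite ger0_norm. Qed.

Lemma measurable_clamp01 : measurable_fun setT clamp01.
Proof. by apply: measurable_maxr => //; exact: measurable_minr. Qed.

(** The events [Z < 0] and [Z > 1] belong to [G], and on each of them [Z - \1_E] has a strict sign.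
    Its integral there is zero, so both events are null. *)
Lemma cond_probability_clamp E Z : measurable E -> integrableR Pr Z ->
  preimages_in Z -> orth (fun x => Z x - \1_E x) ->
  {ae Pr, forall x, clamp01 (Z x) = Z x}.
Proof.
move=> mE iZ GZ oZ.
have mZ := preimages_in_measurable GZ.
have i1 : integrableR Pr (\1_E : Omega -> R).
  exact: integrableR_bounded (normr_indic_le1 E).
have ae0 (A : set Omega) (s : R) : G A ->
    (forall x, A x -> 0 < s * (Z x - \1_E x)) -> {ae Pr, forall x, ~ A x}.
  move=> GA pos; have mA := Gm GA.
  pose f x := s * (\1_A x * (Z x - \1_E x)).
  have mf : measurable_fun setT f.
    by do 2 apply: measurable_funM => //; apply: measurable_funB.
  have f0 x : 0 <= f x.
    rewrite /f mulrCA; have [Ax|nAx] := pselect (A x).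
      by rewrite indicE mem_set// mul1r ltW// pos.
    by rewrite indicE memNset// mul0r.
  have : (\int[Pr]_x `|(f x)%:E| = 0)%E.
    under eq_integral do rewrite gee0_abs ?lee_fin ?f0//.
    rewrite integralRZ ?oZ ?mule0//.
    exact/integrableR_indicM/integrableRB.
  move/(ae_eq_integral_abs Pr measurableT (proj2 (measurable_EFinP _ _) mf)).
  apply: filterS => x /(_ I)[] fx0 Ax.
  by have := pos x Ax; move: fx0; rewrite /f indicE mem_set// mul1r => ->; rewrite ltxx.
have neg : {ae Pr, forall x, ~ (Z @^-1` [set` `]-oo, 0[]) x}.
  apply: (ae0 _ (-1)); first exact: GZ.
  move=> x /=; rewrite in_itv/= => Zx; rewrite mulN1r opprB subr_gt0.
  by rewrite (lt_le_trans Zx)// indicE ler0n.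
have big : {ae Pr, forall x, ~ (Z @^-1` [set` `]1, +oo[]) x}.
  apply: (ae0 _ 1); first exact: GZ.
  move=> x /=; rewrite in_itv/= andbT => Zx; rewrite mul1r subr_gt0.
  by rewrite (le_lt_trans _ Zx)// indicE lern1; case: (_ \in _).
apply: filterS2 neg big => x /=; rewrite !in_itv/= andbT => /negP + /negP.
by rewrite -!leNgt /clamp01 => Z0 Z1; rewrite min_r// max_r.
Qed.

End OrthogonalToSigmaAlgebra.

(** * Conditionally uncorrelated noise *)

Section ConditionallyIndependentNoise.
Context {d : measure_display} {Omega : measurableType d} {R : realType}.
Variables (Pr : probability Omega R) (G : set (set Omega)).
Hypothesis GI : forall A B, G A -> G B -> G (A `&` B).
Hypothesis Gm : forall A, G A -> measurable A.
Variable xi : nat -> Omega -> R.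
Hypothesis xi_L2 : forall i, xi i \in Lfun Pr 2%:E.
Hypothesis xi_indep : cond_independent Pr G xi.
Hypothesis xi_centered : forall i, orth Pr G (xi i).

Let mxi i : measurable_fun setT (xi i).
Proof. by have := xi_L2 i; rewrite inE => /andP[]; rewrite inE. Qed.

Let ixi i : integrableR Pr (xi i).
Proof.
apply/Lfun1_integrable.
apply: (Lfun_subset12 _ (xi_L2 i)).
exact: fin_num_measure.
Qed.

Let mpre i (B : set R) : measurable B -> measurable (xi i @^-1` B).
Proof. by move=> mB; rewrite -[X in measurable X]setTI; exact: mxi. Qed.

(** Let [V] be a version of the conditional probability of the event on [xi k]. The product
    [V * xi i] is orthogonal to [G] because [xi i] is centered, and conditional independence allows
    [V] to be replaced by the indicator. *)
Let orth_indicM i k (C : set R) : i != k -> measurable C ->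
  orth Pr G (fun x => \1_(xi k @^-1` C) x * xi i x).
Proof.
move=> ik mC.
(* The product rule is applied to the family of sets equal to [B] at [i] and to [C] elsewhere, for
   the subfamily [[:: i; k]]. Clamping makes the versions bounded, so that their products are
   integrable. *)
have versions (B : set R) : measurable B -> exists Vi Vk : Omega -> R,
    [/\ preimages_in G Vi /\ preimages_in G Vk,
        (forall x, `|Vi x| <= 1) /\ (forall x, `|Vk x| <= 1),
        orth Pr G (fun x => Vi x - \1_(xi i @^-1` B) x),
        orth Pr G (fun x => Vk x - \1_(xi k @^-1` C) x)
      & orth Pr G (fun x => Vi x * Vk x
          - \1_(xi i @^-1` B) x * \1_(xi k @^-1` C) x)].
  move=> mB.
  have mBC j : measurable (if j == i then B else C) by case: ifP.
  have mEi := mpre i mB; have mEk := mpre k mC.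
  have [Z [Z1 Z2]] := xi_indep mBC.
  have := cond_expectation_orth Gm (Z1 i); rewrite eqxx => -[_ iZi GZi oZi].
  have := cond_expectation_orth Gm (Z1 k).
  rewrite [k == i]eq_sym (negbTE ik) => -[_ iZk GZk oZk].
  have /Z2/(cond_expectation_orth Gm)[iE iZZ _ oZZ] : uniq [:: i; k].
    by rewrite /= inE ik.
  have aei := cond_probability_clamp Gm mEi iZi GZi oZi.
  have aek := cond_probability_clamp Gm mEk iZk GZk oZk.
  have mZi := preimages_in_measurable Gm GZi.
  have mZk := preimages_in_measurable Gm GZk.
  have mci := measurableT_comp measurable_clamp01 mZi.
  have mck := measurableT_comp measurable_clamp01 mZk.
  have m1 (E : set Omega) : measurable E -> measurable_fun setT (\1_E : Omega -> R).
    by move=> mE; exact: measurable_indic.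
  exists (clamp01 \o Z i), (clamp01 \o Z k); split.
  - by split; apply: preimages_in_comp => //; exact: measurable_clamp01.
  - by split=> x; exact: clamp01_norm.
  - apply: (orth_ae_eq Gm _ _ _ oZi); [exact/measurable_funB/m1|exact/measurable_funB/m1|].
    by apply: filterS aei => x /= ->.
  - apply: (orth_ae_eq Gm _ _ _ oZk); [exact/measurable_funB/m1|exact/measurable_funB/m1|].
    by apply: filterS aek => x /= ->.
  - apply: (orth_ae_eq Gm _ _ _ oZZ).
    + exact: measurable_funB (integrableR_measurable iZZ) (integrableR_measurable iE).
    + by apply: measurable_funB; apply: measurable_funM => //; exact: m1.
    + apply: filterS2 aei aek => x /= -> ->.
      rewrite big_cons big_seq1 indicM; congr (_ - \1_ _ x).
      apply/seteqP; split=> y /= H.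
        by split; [have := H i|have := H k]; rewrite /= ?eqxx ?[k == i]eq_sym ?(negbTE ik);
          apply; rewrite !inE eqxx ?orbT.
      by move=> j; rewrite /= !inE => /orP[] /eqP ->; rewrite ?eqxx ?[k == i]eq_sym ?(negbTE ik);
        case: H.
(* The version [Vk] depends on [B]; taking [B = setT] fixes one version [V] once and for all. *)
have [_ [V [[_ GV] [_ V1] _ oV _]]] := versions setT measurableT.
have mV := preimages_in_measurable Gm GV.
have iV := integrableR_bounded Pr mV V1.
have mEk := mpre k mC.
have mI (E : set Omega) : measurable E -> measurable_fun setT (\1_E : Omega -> R).
  by move=> mE; exact: measurable_indic.
have iI (E : set Omega) : measurable E -> integrableR Pr (\1_E : Omega -> R).
  by move=> mE; exact: (integrableR_bounded Pr (mI _ mE) (normr_indic_le1 E)).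
have orthBC (B : set R) : measurable B ->
    orth Pr G (fun x => \1_(xi i @^-1` B) x * (V x - \1_(xi k @^-1` C) x)).
  move=> mB; have mEi := mpre i mB.
  have [Vi [Vk [[GVi GVk] [Vi1 Vk1] oVi oVk oVV]]] := versions B mB.
  have mVi := preimages_in_measurable Gm GVi.
  have mVk := preimages_in_measurable Gm GVk.
  have iVi := integrableR_bounded Pr mVi Vi1.
  have iVk := integrableR_bounded Pr mVk Vk1.
  have oD : orth Pr G (fun x => Vk x - V x).
    rewrite (_ : (fun x => _) = (fun x => (Vk x - \1_(xi k @^-1` C) x)
      - (V x - \1_(xi k @^-1` C) x))); last by apply/funext => x; ring.
    by apply: (orthB Gm) => //; apply: integrableRB => //; exact: iI.
  have i1 : integrableR Pr (fun x => Vi x * (Vk x - V x)).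
    exact: integrableRMl mVi Vi1 (integrableRB iVk iV).
  have i2 : integrableR Pr (fun x => V x * (Vi x - \1_(xi i @^-1` B) x)).
    exact: integrableRMl mV V1 (integrableRB iVi (iI _ mEi)).
  have i3 : integrableR Pr (fun x => Vi x * Vk x
      - \1_(xi i @^-1` B) x * \1_(xi k @^-1` C) x).
    apply: integrableRB; first exact: integrableRMl mVi Vi1 iVk.
    exact: integrableR_indicM mEi (iI _ mEk).
  have o1 := orth_mul GI Gm (integrableRB iVk iV) GVi i1 oD.
  have o2 := orth_mul GI Gm (integrableRB iVi (iI _ mEi)) GV i2 oVi.
  (* The three terms are orthogonal to [G] for different reasons: the first by the product rule, the
     second because [Vk] and [V] are versions of the same conditional probability, the third because
     [Vi] is a version for the event on [xi i]. *)
  rewrite (_ : (fun x => _) = (fun x => (Vi x * Vk x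
      - \1_(xi i @^-1` B) x * \1_(xi k @^-1` C) x)
    - Vi x * (Vk x - V x) - V x * (Vi x - \1_(xi i @^-1` B) x))); last first.
    by apply/funext => x; ring.
  by apply: (orthB Gm) => //; [exact: integrableRB|exact: (orthB Gm)].
have iW : integrableR Pr (fun x => V x - \1_(xi k @^-1` C) x).
  exact: integrableRB iV (iI _ mEk).
have iVxi : integrableR Pr (fun x => V x * xi i x) by exact: integrableRMl mV V1 (ixi i).
have iCxi : integrableR Pr (fun x => \1_(xi k @^-1` C) x * xi i x).
  exact: integrableR_indicM.
(* Orthogonality against all events on [xi i] is upgraded to orthogonality against [xi i] itself. *)
have oW : orth Pr G (fun x => xi i x * (V x - \1_(xi k @^-1` C) x)).
  have iP : integrableR Pr (fun x => xi i x * (V x - \1_(xi k @^-1` C) x)).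
    rewrite (_ : (fun x => _) = (fun x => V x * xi i x
      - \1_(xi k @^-1` C) x * xi i x)); first exact: integrableRB.
    by apply/funext => x; ring.
  move=> A GA; have mA := Gm GA.
  under eq_integral do rewrite mulrCA.
  apply: (@integral_vanish_comp _ _ _ Pr
    (fun x => \1_A x * (V x - \1_(xi k @^-1` C) x)) (xi i)) => //.
  - exact: integrableR_indicM.
  - move=> S mS; under eq_integral do rewrite mulrCA.
    exact: orthBC.
  - under eq_fun do rewrite mulrCA.
    exact: integrableR_indicM.
have oVxi := orth_mul GI Gm (ixi i) GV iVxi (@xi_centered i).
rewrite (_ : (fun x => _) = (fun x => V x * xi i x
    - xi i x * (V x - \1_(xi k @^-1` C) x))); last by apply/funext => x; ring.
apply: (orthB Gm) => //.
rewrite (_ : (fun x => _) = (fun x => V x * xi i x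
  - \1_(xi k @^-1` C) x * xi i x)); first exact: integrableRB.
by apply/funext => x; ring.
Qed.

(** The indicator of an event on [xi k] in [orth_indicM] is replaced by [xi k] itself, again through
    [integral_vanish_comp]. *)
Lemma cond_independent_orth i k : i != k -> orth Pr G (fun x => xi i x * xi k x).
Proof.
move=> ik A GA; have mA := Gm GA.
have iM : integrableR Pr (fun x => xi i x * xi k x).
  exact/Lfun1_integrable/Lfun2_mul_Lfun1.
transitivity (\int[Pr]_x (xi k x * (\1_A x * xi i x))%:E)%E.
  by apply: eq_integral => x _; congr EFin; ring.
apply: integral_vanish_comp.
- exact: integrableR_indicM.
- exact: mxi.
- move=> S mS; under eq_integral do rewrite mulrCA.
  exact: orth_indicM.
- rewrite (_ : (fun x => _) = (fun x => \1_A x * (xi i x * xi k x))).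
    exact: integrableR_indicM.
  by apply/funext => x; ring.
Qed.

Variable (s2 : R).
Hypothesis xi_var : forall i A, G A ->
  (\int[Pr]_x (\1_A x * xi i x ^+ 2)%:E <= s2%:E * Pr A)%E.

(** In the expanded square the off-diagonal terms vanish by conditional uncorrelatedness, since [D],
    [V i] and [V k] are in [G]; the diagonal ones obey the variance bound. *)
Lemma noise_sum_second_moment (n : nat) (V : nat -> set Omega) (D : set Omega) :
  (forall i, G (V i)) -> G D ->
  (\int[Pr]_x (\1_D x * (\sum_(i < n) \1_(V i) x * xi i x) ^+ 2)%:E
    <= s2%:E * \sum_(i < n) Pr (D `&` V i))%E.
Proof.
move=> GV GD.
have GDV i k : G (D `&` V i `&` V k) by do 2 apply: GI => //.
have iM i k : integrableR Pr (fun x => \1_(D `&` V i `&` V k) x * (xi i x * xi k x)).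
  by apply: integrableR_indicM; [exact: Gm|exact/Lfun1_integrable/Lfun2_mul_Lfun1].
rewrite [leLHS](_ : _ = \int[Pr]_x (\sum_(i < n) \sum_(k < n)
    \1_(D `&` V i `&` V k) x * (xi i x * xi k x))%:E)%E; last first.
  apply: eq_integral => x _; congr EFin.
  rewrite expr2 mulr_suml mulr_sumr; apply: eq_bigr => i _.
  rewrite mulr_sumr mulr_sumr; apply: eq_bigr => k _.
  by rewrite -!indicM; ring.
rewrite integralR_sum; last by move=> i; exact: integrableR_sum.
rewrite ge0_sume_distrr//; apply: lee_sum => i _.
rewrite integralR_sum// (bigD1 i)//= big1 ?adde0 => [|k ki].
  have -> : D `&` V i `&` V i = D `&` V i by rewrite -setIA setIid.
  by under eq_integral do rewrite -expr2; apply: xi_var; exact: GI.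
by rewrite cond_independent_orth// eq_sym.
Qed.

End ConditionallyIndependentNoise.

(** * Centering and variance bounds integrated over events *)

Section NoiseGivenChain.
Context {d : measure_display} {Omega : measurableType d} {R : realType}.
Variables (Pr : probability Omega R) (G : set (set Omega)).
Hypothesis GI : forall A B, G A -> G B -> G (A `&` B).
Hypothesis Gm : forall A, G A -> measurable A.
Implicit Types (f g : Omega -> R).

Lemma integral_ae_ge0 f : integrableR Pr f -> {ae Pr, forall x, 0 <= f x} ->
  (0 <= \int[Pr]_x (f x)%:E)%E.
Proof.
move=> fi f0; have mf := integrableR_measurable fi.
rewrite (_ : (\int[Pr]_x _)%E = (\int[Pr]_x (Num.max (f x) 0)%:E)%E).
  by apply: integral_ge0 => x _; rewrite lee_fin le_max lexx orbT.
apply: ae_eq_integral => //.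
- exact/measurable_EFinP.
- by apply/measurable_EFinP; exact: measurable_funrpos.
- by apply: filterS f0 => x fx _; rewrite max_l.
Qed.

Lemma cond_expectation_centered f m : is_cond_expectation Pr G f m ->
  {ae Pr, forall x, m x = 0} -> orth Pr G f.
Proof.
move=> fm m0; have [fi mi _ om] := cond_expectation_orth Gm fm.
have o0 : orth Pr G m.
  apply: (@orth_ae_eq _ _ _ _ _ Gm (fun=> 0)) => //.
  - exact: integrableR_measurable mi.
  - by apply: filterS m0 => x ->.
  - by move=> A GA; under eq_integral do rewrite mulr0; rewrite integral0.
rewrite (_ : f = (fun x => m x - (m x - f x))); last by apply/funext => x; ring.
by apply: (orthB Gm) => //; exact: integrableRB.
Qed.

Lemma cond_expectation_le f v (c : R) A : is_cond_expectation Pr G f v ->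
  {ae Pr, forall x, v x <= c} -> G A ->
  (\int[Pr]_x (\1_A x * f x)%:E <= c%:E * Pr A)%E.
Proof.
move=> fv vc GA; have mA := Gm GA.
have [fi vi _ ov] := cond_expectation_orth Gm fv.
have i1 : integrableR Pr (fun x => \1_A x * (v x - f x)).
  by apply: integrableR_indicM => //; exact: integrableRB.
have i2 : integrableR Pr (fun x => \1_A x * (c - v x)).
  by apply: integrableR_indicM => //; apply: integrableRB => //; exact: integrableR_cst.
have i3 := integrableR_indicM mA fi.
have : (0 <= \int[Pr]_x (\1_A x * (c - v x))%:E)%E.
  apply: integral_ae_ge0 => //.
  by apply: filterS vc => x vx; rewrite mulr_ge0 ?subr_ge0// indicE ler0n.
have <- : (\int[Pr]_x (\1_A x * c)%:E = c%:E * Pr A)%E.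
  under eq_integral do rewrite mulrC.
  rewrite integralRZ; last exact: integrableR_bounded (normr_indic_le1 A).
  by rewrite integral_indic// setIT.
move=> H; rewrite -[leLHS]add0e; apply: (le_trans (leeD2r _ H)).
rewrite -integralRD// -[X in (X <= _)%E]add0e -(ov A GA) -integralRD//.
  rewrite le_eqVlt; apply/orP; left; apply/eqP; apply: eq_integral => x _.
  by congr EFin; ring.
exact: integrableRD.
Qed.

End NoiseGivenChain.

(** * Visits of a Markov chain *)

Section OccupationTimes.
Context {d : measure_display} {Omega : measurableType d} {R : realType}.
Variables (Pr : probability Omega R) (T : metricType R) (K : nat).
Variables (x : 'I_K -> T) (y : T -> 'I_K).
Hypotheses (xK : cancel x y) (yK : cancel y x).
Variables (mu : 'rV[R]_K) (M : 'M[R]_K) (X : nat -> Omega -> T).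
Hypothesis X_markov : markov_chain Pr x mu M X.
Implicit Types (A B : set Omega) (g : 'cV[R]_K).

Definition visit (t : nat) (i : 'I_K) : set Omega := X t @^-1` [set x i].

Let mvisit t i : measurable (visit t i).
Proof. by case: X_markov => + _ _; apply. Qed.

Let visitE t i w : visit t i w <-> y (X t w) = i.
Proof. by split=> [->|<-]; rewrite ?xK// /visit /= yK. Qed.

Let visit_disjoint t i j : i != j -> visit t i `&` visit t j = set0.
Proof.
move=> ij; apply/seteqP; split=> w //= [/visitE + /visitE]; move=> -> ?.
by move/eqP: ij; apply.
Qed.

Definition pr A : R := fine (Pr A).

Lemma prE A : measurable A -> Pr A = (pr A)%:E.
Proof. by move=> mA; rewrite /pr fineK// fin_num_measure. Qed.

Lemma integral_indicE A : measurable A -> (\int[Pr]_w (\1_A w)%:E = Pr A)%E.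
Proof. by move=> mA; rewrite integral_indic// setIT. Qed.

Lemma pr_partition (I : finType) (phi : Omega -> I) B :
  (forall i, measurable (phi @^-1` [set i])) -> measurable B ->
  pr B = \sum_i pr (B `&` phi @^-1` [set i]).
Proof.
move=> mphi mB; apply: EFin_inj.
have mI i : measurable (B `&` phi @^-1` [set i]) by exact: measurableI.
rewrite -prE// -integral_indicE//.
transitivity (\int[Pr]_w (\sum_i \1_(B `&` phi @^-1` [set i]) w)%:E)%E.
  apply: eq_integral => w _; congr EFin; rewrite (bigD1 (phi w))//= big1 => [|i iw].
    rewrite addr0 -indicM [X in _ * X]indicE mem_set ?mulr1//.
  by rewrite -indicM [X in _ * X]indicE memNset ?mulr0//= => /esym/eqP; rewrite (negbTE iw).
rewrite integralR_sum => [|i].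
  by rewrite -sumEFin; apply: eq_bigr => i _; rewrite integral_indicE// prE.
exact: integrable_indic.
Qed.

Let pr_visit_partition t B : measurable B -> pr B = \sum_i pr (B `&` visit t i).
Proof.
move=> mB.
have E i : visit t i = (fun w => y (X t w)) @^-1` [set i].
  by apply/seteqP; split => w /visitE.
under eq_bigr do rewrite E.
by apply: pr_partition => // i; rewrite -E.
Qed.

(** The Markov property concerns completely prescribed pasts; this variable cuts any event into
    finitely many of them. *)
Let path_upto t (w : Omega) : {ffun 'I_t.+1 -> 'I_K} := [ffun s : 'I_t.+1 => y (X s w)].

Let mpath t f : measurable (path_upto t @^-1` [set f]).
Proof.
rewrite (_ : _ @^-1` _ = \bigcap_(s in [set: 'I_t.+1]) visit s (f s)).
  apply: fin_bigcap_measurable => //; exact: finite_finset.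
apply/seteqP; split=> w /=.
  by move=> <- s _; apply/visitE; rewrite ffunE.
by move=> H; apply/ffunP => s; rewrite ffunE; apply/visitE/H.
Qed.

Let visit_path t s i f : (s <= t)%N ->
  visit s i `&` path_upto t @^-1` [set f]
    = if f (inord s) == i then path_upto t @^-1` [set f] else set0.
Proof.
move=> st; have E w : path_upto t w = f -> y (X s w) = f (inord s).
  by move=> <-; rewrite ffunE inordK.
case: eqP => [<-|fi]; apply/seteqP; split=> w //=.
- by case.
- by move=> wf; split => //; apply/visitE/E.
- by case=> /visitE + /E; move=> -> ?; exact: fi.
Qed.

Let pr_path_next t f b : pr (path_upto t @^-1` [set f] `&` visit t.+1 b)
  = pr (path_upto t @^-1` [set f]) * M (f ord_max) b.
Proof.
case: X_markov => _ _ /(_ t (fun s => f (inord s)) b) /=.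
have -> : [set w | forall s, (s <= t)%N -> X s w = x (f (inord s))]
    = path_upto t @^-1` [set f].
  apply/seteqP; split=> w /=.
    move=> H; apply/ffunP => s; rewrite ffunE H ?xK ?inord_val//.
    by rewrite -ltnS.
  by move=> <- s st; rewrite ffunE yK inordK.
have mP : measurable (path_upto t @^-1` [set f]) by exact: mpath.
have mV := mvisit t.+1 b.
rewrite -[[set w | _]]/(visit t.+1 b) prE; last exact: measurableI.
rewrite prE//.
have -> : inord t = ord_max :> 'I_t.+1 by apply: val_inj; rewrite /= inordK.
by rewrite -EFinM => -[].
Qed.

(** On each prescribed path up to time [t], the event [visit s a] is either certain or impossible,
    so the one-step rule for paths can be summed over the paths. *)
Let pr_visit2_next s t a b : (s <= t)%N ->
  pr (visit s a `&` visit t.+1 b) = \sum_c pr (visit s a `&` visit t c) * M c b.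
Proof.
move=> st; have mI u v i j : measurable (visit u i `&` visit v j) by exact: measurableI.
rewrite (pr_partition (@mpath t)) //.
under [RHS]eq_bigr => c _.
  rewrite (pr_partition (@mpath t)) // mulr_suml.
  over.
rewrite exchange_big/=; apply: eq_bigr => f _.
rewrite (bigD1 (f ord_max))//= big1 ?addr0 => [|c cf]; last first.
  rewrite -setIA visit_path//.
  have -> : inord t = ord_max :> 'I_t.+1 by apply: val_inj; rewrite /= inordK.
  by rewrite eq_sym (negbTE cf) setI0 /pr measure0 mul0r.
rewrite -setIA [visit t.+1 b `&` _]setIC setIA visit_path//.
rewrite -setIA visit_path//.
have -> : inord t = ord_max :> 'I_t.+1 by apply: val_inj; rewrite /= inordK.
rewrite eqxx visit_path//; case: ifP => _; last by rewrite set0I /pr measure0 mul0r.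
exact: pr_path_next.
Qed.

Lemma pr_visit t a : pr (visit t a) = (mu *m M ^+ t) 0 a.
Proof.
elim: t a => [|t IH] a.
  rewrite expr0 mulmx1; case: X_markov => _ /(_ a) + _.
  by rewrite /pr => ->.
rewrite (pr_visit_partition t)// exprSr -[M ^+ t * M]/(M ^+ t *m M) mulmxA mxE.
apply: eq_bigr => c _; rewrite setIC pr_visit2_next// -IH (bigD1 c)//= setIid big1 ?addr0// => e ec.
by rewrite visit_disjoint 1?eq_sym// /pr measure0 mul0r.
Qed.

Lemma pr_visit2 s k a b :
  pr (visit s a `&` visit (s + k) b) = (mu *m M ^+ s) 0 a * (M ^+ k) a b.
Proof.
elim: k b => [|k IH] b.
  rewrite addn0 expr0 [X in _ = _ * X]mxE; have [->|ab] := eqVneq a b.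
    by rewrite setIid ?eqxx mulr1 pr_visit.
  by rewrite mulr0 visit_disjoint// /pr measure0.
rewrite addnS pr_visit2_next ?leq_addr// exprSr [X in _ = _ * X]mxE mulr_sumr.
by apply: eq_bigr => c _; rewrite IH mulrA.
Qed.

Let g_indic g t w : g (y (X t w)) 0 = \sum_i g i 0 * \1_(visit t i) w.
Proof.
rewrite (bigD1 (y (X t w)))//= big1 ?addr0 => [|i iw].
  by rewrite indicE mem_set ?mulr1//; apply/visitE.
by rewrite indicE memNset ?mulr0// => /visitE/esym/eqP; rewrite (negbTE iw).
Qed.

Lemma integral_two_point g s t :
  (\int[Pr]_w (g (y (X s w)) 0 * g (y (X t w)) 0)%:E
    = ((mu *m two_point M g s t) 0 0)%:E)%E.
Proof.
wlog st : s t / (s <= t)%N.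
  move=> H; have [/H//|/ltnW/H ts] := leqP s t.
  under eq_integral do rewrite mulrC.
  by rewrite ts /two_point minnC addnC.
rewrite -(subnKC st); move: (t - s)%N => k {t st}.
have iI i j : integrableR Pr (fun w => g i 0 * g j 0 * \1_(visit s i `&` visit (s + k) j) w).
  have := integrable_indic Pr (measurableI _ _ (mvisit s i) (mvisit (s + k) j)).
  by move=> /(integrableZl measurableT (g i 0 * g j 0)); apply: eq_integrable.
transitivity (\int[Pr]_w (\sum_i \sum_j
    g i 0 * g j 0 * \1_(visit s i `&` visit (s + k) j) w)%:E)%E.
  apply: eq_integral => w _; congr EFin; rewrite !g_indic mulr_suml.
  apply: eq_bigr => i _; rewrite mulr_sumr; apply: eq_bigr => j _.
  by rewrite -indicM; ring.
rewrite integralR_sum; last by move=> i; exact: integrableR_sum.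
rewrite /two_point (minn_idPl (leq_addr _ _)) mulmxA.
have -> : (s - (s + k) + (s + k - s) = k)%N by lia.
rewrite mxE -sumEFin; apply: eq_bigr => i _.
rewrite integralR_sum// mxE [(M ^+ k *m g) i 0]mxE !mulr_sumr -sumEFin.
apply: eq_bigr => j _.
have mIJ : measurable (visit s i `&` visit (s + k) j) by exact: measurableI.
rewrite integralRZ; last exact: integrable_indic.
by rewrite integral_indicE// prE// pr_visit2 -EFinM; congr EFin; ring.
Qed.

Lemma integral_second_moment g n :
  (\int[Pr]_w ((\sum_(t < n) g (y (X t w)) 0) ^+ 2)%:E
    = ((mu *m second_moment M g n) 0 0)%:E)%E.
Proof.
have mg t : measurable_fun setT (fun w => g (y (X t w)) 0).
  under eq_fun do rewrite g_indic.
  by apply: measurable_sum => i; apply: measurable_funM => //; exact: measurable_indic.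
have bg t w : `|g (y (X t w)) 0| <= \sum_i `|g i 0|.
  by rewrite (bigD1 (y (X t w)))//= lerDl sumr_ge0.
have ig s t : integrableR Pr (fun w => g (y (X s w)) 0 * g (y (X t w)) 0).
  exact: integrableRMl (mg s) (bg s) (integrableR_bounded Pr (mg t) (bg t)).
under eq_integral => w _.
  rewrite expr2 mulr_suml; under eq_bigr => s _ do rewrite mulr_sumr.
  over.
rewrite integralR_sum; last by move=> s; exact: integrableR_sum.
rewrite /second_moment mulmx_sumr summxE -sumEFin; apply: eq_bigr => s _.
rewrite integralR_sum// mulmx_sumr summxE -sumEFin; apply: eq_bigr => t _.
exact: integral_two_point.
Qed.

Lemma integral_occupation (pi : 'rV[R]_K) n j :
  (\int[Pr]_w ((\sum_(t < n) \1_(visit t j) w - n%:R * pi 0 j) ^+ 2)%:E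
    = ((mu *m second_moment M (\col_i ((i == j)%:R - pi 0 j)) n) 0 0)%:E)%E.
Proof.
rewrite -integral_second_moment; apply: eq_integral => w _; congr (_ ^+ 2)%:E.
rewrite -[n in n%:R]card_ord mulr_natl -sumr_const -sumrB.
apply: eq_bigr => t _; rewrite mxE indicE; congr (_ - _).
have [<-|yj] := eqVneq; first by rewrite mem_set//; apply/visitE.
by rewrite memNset// => /visitE/eqP; rewrite (negbTE yj).
Qed.

End OccupationTimes.

(** * Noise at the visits of a state *)

Section GeneratedSystems.
Context {d : measure_display} {Omega : measurableType d} {R : realType}.
Variable Pr : probability Omega R.
Implicit Types (G H : set (set Omega)) (f g : Omega -> R).

Lemma g_sigma_algebraI G A B : <<s G >> A -> <<s G >> B -> <<s G >> (A `&` B).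
Proof. exact: (@measurableI _ (g_sigma_algebraType G)). Qed.

Lemma g_sigma_algebra_measurable G : (forall A, G A -> measurable A) ->
  forall A, <<s G >> A -> measurable A.
Proof. by move=> Gm; apply: smallest_sub => //; exact: sigma_algebra_measurable. Qed.

Lemma measurable_preimages_in G f :
  measurable_fun (setT : set (g_sigma_algebraType G)) f <-> preimages_in <<s G >> f.
Proof.
split=> [mf S mS|Gf _ S mS]; last by rewrite setTI; exact: Gf.
by rewrite -[X in <<s _ >> X]setTI; exact: mf.
Qed.

Lemma independent_systems_sym G H : independent_systems Pr G H ->
  independent_systems Pr H G.
Proof. by move=> i A B HA GB; rewrite setIC i// muleC. Qed.

(** Independence makes [\1_F - Pr F] integrate to zero over every preimage under [g], hence also
    against [g]. *)
Lemma independent_integral G H F g : independent_systems Pr G H ->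
  (forall A, G A -> measurable A) -> H F -> measurable F ->
  preimages_in G g -> integrableR Pr g ->
  (\int[Pr]_w (\1_F w * g w)%:E = Pr F * \int[Pr]_w (g w)%:E)%E.
Proof.
move=> GH Gm HF mF Gg ig.
have mg := preimages_in_measurable Gm Gg.
have iF : integrableR Pr (\1_F : Omega -> R) by exact: integrable_indic.
have iW : integrableR Pr (fun w => \1_F w - pr Pr F).
  by apply: integrableRB => //; exact: integrableR_cst.
have i1 : integrableR Pr (fun w => \1_F w * g w) by exact: integrableR_indicM.
have i2 : integrableR Pr (fun w => pr Pr F * g w).
  by apply: eq_integrable (integrableZl measurableT (pr Pr F) ig).
have iP : integrableR Pr (fun w => g w * (\1_F w - pr Pr F)).
  rewrite (_ : (fun w => _) = (fun w => \1_F w * g w - pr Pr F * g w)).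
    exact: integrableRB.
  by apply/funext => w; ring.
have : (\int[Pr]_w (g w * (\1_F w - pr Pr F))%:E = 0)%E.
  apply: (integral_vanish_comp iW mg) => // S mS.
  have GS : G (g @^-1` S) by exact: Gg.
  have mgS := Gm _ GS.
  have iS : integrableR Pr (\1_(g @^-1` S) : Omega -> R) by exact: integrable_indic.
  transitivity (\int[Pr]_w (\1_(g @^-1` S `&` F) w - pr Pr F * \1_(g @^-1` S) w)%:E)%E.
    by apply: eq_integral => w _; congr EFin; rewrite -indicM; ring.
  rewrite integralRB; first last.
  - by apply: eq_integrable (integrableZl measurableT (pr Pr F) iS).
  - by apply: integrable_indic; exact: measurableI.
  rewrite integralRZ// !integral_indicE//; last exact: measurableI.
  rewrite (GH _ _ GS HF) -prE// muleC subee// fin_numM//; exact: fin_num_measure.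
rewrite (_ : (\int[Pr]_w _)%E = (\int[Pr]_w (\1_F w * g w - pr Pr F * g w)%:E)%E); last first.
  by apply: eq_integral => w _; congr EFin; ring.
rewrite integralRB// integralRZ// -prE// => /eqP; rewrite sube_eq ?add0e.
- by move/eqP.
- exact: integrable_fin_num.
- by rewrite fin_num_adde_defr// fin_numM ?fin_num_measure// integrable_fin_num.
Qed.

End GeneratedSystems.

(** * Noise accumulated by one chain at a fixed state *)

Section NoisyChain.
Context {d : measure_display} {Omega : measurableType d} {R : realType}.
Variables (Pr : probability Omega R) (T : metricType R).
Variables (X : nat -> Omega -> T) (xi : nat -> Omega -> R) (sigma : R).
Hypothesis mX : forall t (A : set T), measurable (X t @^-1` A).
Hypothesis xi_noise : noise_given_chain Pr X xi sigma.
Variables (z : T) (n : nat).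

(** The count is a natural number, so that its level sets cut [Omega] into finitely many cells. *)
Definition hits (w : Omega) : nat := (\sum_(t < n) (X t w \in [set z]))%N.

Definition noise_sum (w : Omega) : R := \sum_(t < n) \1_(X t @^-1` [set z]) w * xi t w.

Let G := sigma_chain X.
Let H := sigma_chain_noise X xi.

Let GI A B : G A -> G B -> G (A `&` B). Proof. exact: g_sigma_algebraI. Qed.

Lemma sigma_chain_preimage t (A : set T) : G (X t @^-1` A).
Proof.
by apply: sub_gen_smallest; exists t => //; exists A => //; rewrite setTI.
Qed.

Lemma sigma_chain_measurable A : G A -> measurable A.
Proof.
apply: g_sigma_algebra_measurable => _ [t _ [B _ <-]].
by rewrite setTI; exact: mX.
Qed.

Lemma sigma_chain_sub_noise : G `<=` H.
Proof. by apply: sub_sigma_algebra2 => A ?; left. Qed.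

Let mxi t : measurable_fun setT (xi t).
Proof. by case: xi_noise => /(_ t) + _ _ _; rewrite inE => /andP[]; rewrite inE. Qed.

Lemma sigma_chain_noise_measurable A : H A -> measurable A.
Proof.
apply: g_sigma_algebra_measurable => _ [[t _ [B _ <-]]|[t _ [B mB <-]]].
  by rewrite setTI; exact: mX.
exact: mxi.
Qed.

Lemma hits_le w : (hits w <= n)%N.
Proof.
rewrite /hits -[leqRHS]card_ord -sum1_card; apply: leq_sum => t _.
by case: (_ \in _).
Qed.

Lemma hitsE w : (hits w)%:R = \sum_(t < n) \1_(X t @^-1` [set z]) w :> R.
Proof.
rewrite /hits natr_sum; apply: eq_bigr => t _; rewrite indicE.
by congr (nat_of_bool _)%:R; apply/idP/idP; rewrite !inE.
Qed.

Lemma hits_preimages_in : preimages_in G (fun w => (hits w)%:R : R).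
Proof.
have -> : (fun w => (hits w)%:R : R) = (fun w => \sum_(t < n) \1_(X t @^-1` [set z]) w).
  by apply/funext => w; exact: hitsE.
apply/measurable_preimages_in.
apply: measurable_sum => t; apply: measurable_indic.
exact: sigma_chain_preimage.
Qed.

Lemma sigma_chain_hits m : G (hits @^-1` [set m]).
Proof.
have -> : hits @^-1` [set m] = (fun w => (hits w)%:R : R) @^-1` [set m%:R].
  by apply/seteqP; split=> w /= => [->//|/eqP]; rewrite eqr_nat => /eqP.
exact: hits_preimages_in.
Qed.

Let iN : integrableR Pr (fun w => (hits w)%:R : R).
Proof.
apply: (@integrableR_bounded _ _ _ _ _ n%:R).
  exact (preimages_in_measurable (@sigma_chain_measurable) hits_preimages_in).
by move=> w; rewrite ger0_norm// ler_nat hits_le.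
Qed.

Lemma integrable_noise_sum_sqr : integrableR Pr (fun w => noise_sum w ^+ 2).
Proof.
case: xi_noise => L2 _ _ _.
rewrite (_ : (fun w => _) = (fun w => \sum_(s < n) \sum_(t < n)
    \1_(X s @^-1` [set z] `&` X t @^-1` [set z]) w * (xi s w * xi t w))).
  apply: integrableR_sum => s; apply: integrableR_sum => t.
  apply: integrableR_indicM; first exact: measurableI.
  exact/Lfun1_integrable/Lfun2_mul_Lfun1.
apply/funext => w; rewrite expr2 mulr_suml; apply: eq_bigr => s _.
by rewrite mulr_sumr; apply: eq_bigr => t _; rewrite -indicM; ring.
Qed.

Lemma measurable_noise_sum : measurable_fun setT noise_sum.
Proof.
by apply: measurable_sum => t; apply: measurable_funM => //; exact: measurable_indic.
Qed.

Lemma noise_sum_preimages_in D : G D -> preimages_in H (fun w => \1_D w * noise_sum w ^+ 2).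
Proof.
move=> GD; apply/measurable_preimages_in.
apply: measurable_funM.
  by apply: measurable_indic; exact: sigma_chain_sub_noise.
apply: measurable_funX; apply: measurable_sum => t; apply: measurable_funM.
  by apply: measurable_indic; apply: sigma_chain_sub_noise; exact: sigma_chain_preimage.
apply/measurable_preimages_in => S mS; apply: sub_gen_smallest; right.
by exists t => //; exists S => //; rewrite setTI.
Qed.

Lemma noise_sum_sqr_le D : G D ->
  (\int[Pr]_w (\1_D w * noise_sum w ^+ 2)%:E
    <= (sigma ^+ 2)%:E * \int[Pr]_w (\1_D w * (hits w)%:R)%:E)%E.
Proof.
move=> GD; have [L2 ci cen var] := xi_noise.
have mD := sigma_chain_measurable GD.
have iDt t : integrableR Pr (fun w => \1_(D `&` X t @^-1` [set z]) w : R).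
  by apply: integrable_indic; exact: measurableI.
have -> : (\int[Pr]_w (\1_D w * (hits w)%:R)%:E
    = \sum_(t < n) Pr (D `&` X t @^-1` [set z]))%E.
  transitivity (\int[Pr]_w (\sum_(t < n) \1_(D `&` X t @^-1` [set z]) w)%:E)%E.
    apply: eq_integral => w _; rewrite hitsE mulr_sumr; congr EFin.
    by apply: eq_bigr => t _; rewrite indicM.
  by rewrite integralR_sum//; apply: eq_bigr => t _; rewrite integral_indicE//; exact: measurableI.
have xi_orth t : orth Pr G (xi t).
  have [m xm m0] := cen t.
  exact (cond_expectation_centered (@sigma_chain_measurable) xm m0).
have xi_var t A : G A -> (\int[Pr]_w (\1_A w * xi t w ^+ 2)%:E <= (sigma ^+ 2)%:E * Pr A)%E.
  move=> GA; have [v xv vs] := var t.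
  exact (cond_expectation_le (@sigma_chain_measurable) xv vs GA).
have GV t : G (X t @^-1` [set z]) by exact: sigma_chain_preimage.
exact (noise_sum_second_moment GI (@sigma_chain_measurable) L2 ci xi_orth xi_var n GV GD).
Qed.

Variables (G' : set (set Omega)) (hits' : Omega -> nat) (n' : nat).
Hypotheses (indep : independent_systems Pr H G') (G'm : forall A, G' A -> measurable A).
Hypotheses (hits'_le : forall w, (hits' w <= n')%N)
  (G'_hits : forall l, G' (hits' @^-1` [set l])).

(** Any weight depending on both counts is a finite combination of products of cell indicators;
    measurability and the expansion of integrals follow from this. *)
Lemma two_cells (phi : nat -> nat -> R) w : phi (hits w) (hits' w)
  = \sum_(m < n.+1) \sum_(l < n'.+1)
      phi m l * (\1_(hits' @^-1` [set nat_of_ord l]) w * \1_(hits @^-1` [set nat_of_ord m]) w).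
Proof.
have h1 : (hits w < n.+1)%N by rewrite ltnS hits_le.
have h2 : (hits' w < n'.+1)%N by rewrite ltnS.
rewrite (bigD1 (Ordinal h1))//= [X in _ + X]big1 ?addr0 => [|m mh].
  rewrite (bigD1 (Ordinal h2))//= [X in _ + X]big1 ?addr0 => [|l lh].
    by rewrite !indicE !mem_set// !mulr1.
  rewrite [X in _ * (X * _)]indicE memNset ?mul0r ?mulr0//= => lE.
  by move/negP: lh; apply; apply/eqP/val_inj.
apply: big1 => l _; rewrite [X in _ * (_ * X)]indicE memNset ?mulr0//= => mE.
by move/negP: mh; apply; apply/eqP/val_inj.
Qed.

Lemma measurable_two_cells (phi : nat -> nat -> R) :
  measurable_fun setT (fun w => phi (hits w) (hits' w)).
Proof.
under eq_fun do rewrite two_cells.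
apply: measurable_sum => m; apply: measurable_sum => l.
apply: measurable_funM => //; apply: measurable_funM; apply: measurable_indic.
  by apply: G'm; exact: G'_hits.
by apply: sigma_chain_measurable; exact: sigma_chain_hits.
Qed.

Lemma two_cells_bounded (phi : nat -> nat -> R) w : `|phi (hits w) (hits' w)|
  <= \sum_(m < n.+1) \sum_(l < n'.+1) `|phi m l|.
Proof.
have h1 : (hits w < n.+1)%N by rewrite ltnS hits_le.
have h2 : (hits' w < n'.+1)%N by rewrite ltnS.
rewrite (bigD1 (Ordinal h1))//= (bigD1 (Ordinal h2))//= -addrA lerDl.
by rewrite addr_ge0// ?sumr_ge0// => i _; rewrite sumr_ge0.
Qed.

(* The weight is constant on each event [hits = m, hits' = l], and [hits'] is
   independent of the noise and of [hits]. *)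
Lemma noise_sum_weighted (phi : nat -> nat -> R) : (forall m l, 0 <= phi m l) ->
  (\int[Pr]_w (phi (hits w) (hits' w) * noise_sum w ^+ 2)%:E
    <= (sigma ^+ 2)%:E * \int[Pr]_w (phi (hits w) (hits' w) * (hits w)%:R)%:E)%E.
Proof.
move=> phi0.
pose E l := hits' @^-1` [set l]; pose D m := hits @^-1` [set m].
have mD m : measurable (D m) by (apply: sigma_chain_measurable; exact: sigma_chain_hits).
have mE l : measurable (E l) by apply: G'm; exact: G'_hits.
have expand (g : Omega -> R) : integrableR Pr g ->
    (\int[Pr]_w (phi (hits w) (hits' w) * g w)%:E
      = \sum_(m < n.+1) \sum_(l < n'.+1) (phi m l)%:E
          * \int[Pr]_w (\1_(E l) w * (\1_(D m) w * g w))%:E)%E.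
  move=> ig.
  have iC m l : integrableR Pr (fun w => \1_(E l) w * (\1_(D m) w * g w)).
    exact/integrableR_indicM/integrableR_indicM.
  have iC' m l : integrableR Pr (fun w => phi m l * (\1_(E l) w * (\1_(D m) w * g w))).
    by apply: eq_integrable (integrableZl measurableT (phi m l) (iC m l)).
  transitivity (\int[Pr]_w (\sum_(m < n.+1) \sum_(l < n'.+1)
      phi m l * (\1_(E l) w * (\1_(D m) w * g w)))%:E)%E.
    apply: eq_integral => w _; congr EFin; rewrite two_cells mulr_suml.
    apply: eq_bigr => m _; rewrite mulr_suml; apply: eq_bigr => l _.
    by rewrite -!mulrA.
  rewrite integralR_sum => [|m]; last exact: integrableR_sum.
  apply: eq_bigr => m _; rewrite integralR_sum//; apply: eq_bigr => l _.
  by rewrite integralRZ.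
rewrite expand; last exact: integrable_noise_sum_sqr.
rewrite expand// ge0_sume_distrr; last first.
  move=> m _; apply: sume_ge0 => l _; apply: mule_ge0; first by rewrite lee_fin; exact: phi0.
  by apply: integral_ge0 => w _; rewrite lee_fin !mulr_ge0// indicE ler0n.
apply: lee_sum => m _; rewrite ge0_sume_distrr; last first.
  move=> l _; apply: mule_ge0; first by rewrite lee_fin; exact: phi0.
  by apply: integral_ge0 => w _; rewrite lee_fin !mulr_ge0// indicE ler0n.
apply: lee_sum => l _; rewrite muleCA; apply: lee_wpmul2l; first by rewrite lee_fin; exact: phi0.
(* On both sides the cell of the other chain factors out by independence as the same probability,
   which leaves the bound of [noise_sum_sqr_le] on a cell of the chain itself. *)
rewrite (independent_integral indep (@sigma_chain_noise_measurable) (G'_hits l) (mE l)); first last.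
- exact/integrableR_indicM/integrable_noise_sum_sqr.
- by apply: noise_sum_preimages_in; exact: sigma_chain_hits.
rewrite (independent_integral indep (@sigma_chain_noise_measurable) (G'_hits l) (mE l)); first last.
- exact: integrableR_indicM.
- move=> S mS; apply: sigma_chain_sub_noise; move: S mS.
  apply/measurable_preimages_in; apply: measurable_funM.
    by apply: measurable_indic; exact: sigma_chain_hits.
  by apply/measurable_preimages_in; exact: hits_preimages_in.
rewrite muleCA; apply: lee_wpmul2l; first exact: measure_ge0.
by apply: noise_sum_sqr_le; exact: sigma_chain_hits.
Qed.

End NoisyChain.

(** * Risk of the estimator *)

Section VisitCounts.
Variable R : realType.

(* When [a + b = 0] the inverse on the left-hand side is [0]. *)
Lemma inverse_count_le (F2 s2 p q m : R) (a b : nat) : 0 < m -> 0 <= F2 -> 0 <= s2 ->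
  m = p + q ->
  F2 * ((a + b)%N == 0)%:R + 2 * s2 * (((a + b)%:R ^+ 2)^-1 * a%:R + ((a + b)%:R ^+ 2)^-1 * b%:R)
    <= 4 * s2 / m + 2 * (F2 + 8 * s2) / m ^+ 2 * ((a%:R - p) ^+ 2 + (b%:R - q) ^+ 2).
Proof.
move=> m0 F0 s0 mE.
set c := (a + b)%N; pose D : R := c%:R - m.
have m20 : 0 < m ^+ 2 by rewrite exprn_gt0.
have DE : D ^+ 2 <= 2 * ((a%:R - p) ^+ 2 + (b%:R - q) ^+ 2).
  have -> : D = (a%:R - p) + (b%:R - q) by rewrite /D /c natrD mE; ring.
  by have := sqr_ge0 ((a%:R - p) - (b%:R - q)); nra.
have D0 : 0 <= D ^+ 2 / m ^+ 2 by rewrite divr_ge0 ?sqr_ge0// ltW.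
have zero : (c == 0)%:R <= D ^+ 2 / m ^+ 2.
  rewrite /D; case: eqP => [->|_]; last exact: D0.
  by rewrite sub0r sqrrN divff// gt_eqF.
(* If [c >= m / 2] the first term suffices. Otherwise [c] deviates from [m] by more than [m / 2],
   the second term is at least 1, and [1 / c] is at most 1, being 0 by convention when [c = 0]. *)
have inv : (c%:R : R)^-1 <= 2 / m + 4 * (D ^+ 2 / m ^+ 2).
  have m1 : 0 <= 2 / m by rewrite divr_ge0// ltW.
  have [c0|c0] := posnP c; first by rewrite {1}c0 invr0 addr_ge0// (mulr_ge0 _ D0).
  have c1 : 1 <= c%:R :> R by rewrite ler1n.
  have [mc|cm] := leP (m / 2) c%:R.
    rewrite -[leLHS]addr0 lerD ?(mulr_ge0 _ D0)//.
    by rewrite -[leRHS]invrK lef_pV2 ?posrE ?invr_gt0 ?divr_gt0 ?ltr0n// invf_div.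
  apply: (@le_trans _ _ 1); first by rewrite invf_le1// (lt_le_trans ltr01).
  rewrite -[leLHS]add0r lerD// mulrA ler_pdivlMr// mul1r.
  by rewrite /D; nra.
have -> : ((c%:R : R) ^+ 2)^-1 * a%:R + (c%:R ^+ 2)^-1 * b%:R = c%:R^-1.
  rewrite -mulrDr -natrD -/c; have [->|c0] := eqVneq c 0%N; first by rewrite mulr0 invr0.
  by field; rewrite pnatr_eq0.
apply: (@le_trans _ _ (F2 * (D ^+ 2 / m ^+ 2) + 2 * s2 * (2 / m + 4 * (D ^+ 2 / m ^+ 2)))).
  by rewrite lerD// ler_wpM2l// mulr_ge0.
rewrite [leLHS](_ : _ = 4 * s2 / m + (F2 + 8 * s2) / m ^+ 2 * D ^+ 2); last by ring.
rewrite lerD2l; apply: (@le_trans _ _ ((F2 + 8 * s2) / m ^+ 2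
    * (2 * ((a%:R - p) ^+ 2 + (b%:R - q) ^+ 2)))).
  by rewrite ler_wpM2l// divr_ge0 ?addr_ge0 ?mulr_ge0// ltW.
by rewrite le_eqVlt; apply/orP; left; apply/eqP; ring.
Qed.

End VisitCounts.

Lemma concat_sum (d : measure_display) (Omega : measurableType d) (S : Type) (V : nmodType)
  (g : S -> V) (ZP ZQ : nat -> Omega -> S) nP nQ w :
  \sum_(i < nP + nQ) g (concat_sample nP ZP ZQ i w)
    = \sum_(i < nP) g (ZP i w) + \sum_(i < nQ) g (ZQ i w).
Proof.
rewrite big_split_ord /=; congr (_ + _); apply: eq_bigr => i _; rewrite /concat_sample /=.
  by rewrite ltn_ord.
by rewrite ltnNge leq_addr /= addKn.
Qed.

(** * Squared error at a single state *)

Section StateRisk.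
Context {d : measure_display} {Omega : measurableType d} {R : realType}.
Variables (Pr : probability Omega R) (T : metricType R).
Variables (XP XQ : nat -> Omega -> T) (xiP xiQ : nat -> Omega -> R) (sigma : R).
Hypothesis mXP : forall t (A : set T), measurable (XP t @^-1` A).
Hypothesis mXQ : forall t (A : set T), measurable (XQ t @^-1` A).
Hypothesis xiP_noise : noise_given_chain Pr XP xiP sigma.
Hypothesis xiQ_noise : noise_given_chain Pr XQ xiQ sigma.
Hypothesis PQ_indep : independent_systems Pr
  (sigma_chain_noise XP xiP) (sigma_chain_noise XQ xiQ).
Variables (f : T -> R) (z : T) (nP nQ : nat) (h : R).
Hypothesis h_ball : closed_metric_ball z h = [set z].

Let cP := hits XP z nP.
Let cQ := hits XQ z nQ.
Let AP := noise_sum XP xiP z nP.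
Let AQ := noise_sum XQ xiQ z nQ.
Let fhat := nadaraya_watson (nP + nQ) h (concat_sample nP XP XQ)
  (fun i w => f (concat_sample nP XP XQ i w) + concat_sample nP xiP xiQ i w).

Let cP_le w : (cP w <= nP)%N. Proof. exact: hits_le. Qed.
Let cQ_le w : (cQ w <= nQ)%N. Proof. exact: hits_le. Qed.

Let GcQ l : sigma_chain XQ (cQ @^-1` [set l]).
Proof. by apply: sigma_chain_hits. Qed.
Let GcP l : sigma_chain XP (cP @^-1` [set l]).
Proof. by apply: sigma_chain_hits. Qed.

Let GQm A : sigma_chain XQ A -> measurable A.
Proof. exact: sigma_chain_measurable. Qed.
Let GPm A : sigma_chain XP A -> measurable A.
Proof. exact: sigma_chain_measurable. Qed.

Let indepPQ : independent_systems Pr (sigma_chain_noise XP xiP) (sigma_chain XQ).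
Proof. by move=> A B GA GB; apply: PQ_indep => //; exact: sigma_chain_sub_noise. Qed.

Let indepQP : independent_systems Pr (sigma_chain_noise XQ xiQ) (sigma_chain XP).
Proof.
move=> A B GA GB; apply: (independent_systems_sym PQ_indep) => //.
exact: sigma_chain_sub_noise.
Qed.

Let mcount (psi : nat -> nat -> R) : measurable_fun setT (fun w => psi (cP w) (cQ w)).
Proof. exact (measurable_two_cells mXP z nP GQm cQ_le GcQ psi). Qed.

Let icount (psi : nat -> nat -> R) : integrableR Pr (fun w => psi (cP w) (cQ w)).
Proof.
exact (integrableR_bounded Pr (mcount psi) (two_cells_bounded XP z nP cQ_le psi)).
Qed.

Lemma nadaraya_watson_state w :
  fhat w z = (f z * (cP w + cQ w)%:R + (AP w + AQ w)) / (cP w + cQ w)%:R.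
Proof.
rewrite /fhat /nadaraya_watson h_ball.
have NE : \sum_(i < nP + nQ) \1_[set z] (concat_sample nP XP XQ i w)
    = (cP w + cQ w)%:R :> R.
  by rewrite (concat_sum (\1_[set z] : T -> R)) natrD !hitsE.
rewrite NE.
have -> : \sum_(i < nP + nQ) (f (concat_sample nP XP XQ i w)
    + concat_sample nP xiP xiQ i w) * \1_[set z] (concat_sample nP XP XQ i w)
    = f z * (cP w + cQ w)%:R + (AP w + AQ w).
  (* The observations are regarded as one concatenated sample of pairs (state, noise), so that
     [concat_sum] splits states and noise together. *)
  pose g (u : T * R) : R := (f u.1 + u.2) * \1_[set z] u.1.
  transitivity (\sum_(i < nP + nQ) g (concat_sample nP
      (fun i w => (XP i w, xiP i w)) (fun i w => (XQ i w, xiQ i w)) i w)).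
    by apply: eq_bigr => i _; rewrite /concat_sample /g; case: ifP.
  have gE Z (zeta : nat -> Omega -> R) i : g (Z i w, zeta i w)
      = f z * \1_(Z i @^-1` [set z]) w + \1_(Z i @^-1` [set z]) w * zeta i w.
    rewrite /g /= -[\1_[set z] (Z i w)]/(\1_(Z i @^-1` [set z]) w).
    have [Zz|Zz] := pselect ((Z i @^-1` [set z]) w); rewrite indicE.
      by rewrite mem_set// Zz !mulr1 mul1r.
    by rewrite memNset// !mulr0 mul0r addr0.
  rewrite concat_sum natrD !hitsE mulrDr !mulr_sumr addrACA -!big_split /=.
  by congr (_ + _); apply: eq_bigr => i _; rewrite gE.
(* Without any visit the estimator is 0 by definition, which agrees with division by zero. *)
case: ltrP => // c0.
have /eqP -> : (cP w + cQ w)%:R == 0 :> R by rewrite eq_le c0 ler0n.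
by rewrite invr0 mulr0.
Qed.

(** The noise of the two chains enters through separate squares, so that each can be integrated
    given its own chain. Without visits the inverse is 0 and only [F2], a bound on the squared
    regression function, remains. *)
Definition state_bound (F2 : R) w : R :=
  F2 * ((cP w + cQ w)%N == 0)%:R
  + 2 * (((cP w + cQ w)%:R ^+ 2)^-1 * AP w ^+ 2 + ((cP w + cQ w)%:R ^+ 2)^-1 * AQ w ^+ 2).

Lemma measurable_nadaraya_watson : measurable_fun setT (fun w => fhat w z).
Proof.
under eq_fun do rewrite nadaraya_watson_state.
apply: measurable_funM; last exact: (mcount (fun a b => ((a + b)%:R)^-1)).
apply: measurable_funD.
  exact: (mcount (fun a b => f z * (a + b)%:R)).
exact (measurable_funD (measurable_noise_sum mXP xiP_noise z nP)
  (measurable_noise_sum mXQ xiQ_noise z nQ)).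
Qed.

Lemma risk_le_state_bound F2 w : f z ^+ 2 <= F2 -> (fhat w z - f z) ^+ 2 <= state_bound F2 w.
Proof.
move=> fF; rewrite nadaraya_watson_state /state_bound.
set c := (cP w + cQ w)%N; have [c0|c0] := eqVneq c 0%N.
  by rewrite c0 invr0 mulr0 sub0r sqrrN mulr1 expr0n /= invr0 !mul0r addr0 mulr0 addr0.
have cR : (c%:R : R) != 0 by rewrite pnatr_eq0.
rewrite mulr0 add0r.
have -> : (f z * c%:R + (AP w + AQ w)) / c%:R - f z = (AP w + AQ w) / c%:R by field.
rewrite exprMn exprVn -mulrDr mulrCA [leLHS]mulrC ler_wpM2l ?invr_ge0 ?sqr_ge0//.
by have := sqr_ge0 (AP w - AQ w); nra.
Qed.

Let iAP : integrableR Pr (fun w => ((cP w + cQ w)%:R ^+ 2)^-1 * AP w ^+ 2).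
Proof.
exact (integrableRMl (mcount (fun a b => ((a + b)%:R ^+ 2)^-1))
  (two_cells_bounded XP z nP cQ_le (fun a b => ((a + b)%:R ^+ 2)^-1))
  (integrable_noise_sum_sqr mXP xiP_noise z nP)).
Qed.

Let iAQ : integrableR Pr (fun w => ((cP w + cQ w)%:R ^+ 2)^-1 * AQ w ^+ 2).
Proof.
exact (integrableRMl (mcount (fun a b => ((a + b)%:R ^+ 2)^-1))
  (two_cells_bounded XP z nP cQ_le (fun a b => ((a + b)%:R ^+ 2)^-1))
  (integrable_noise_sum_sqr mXQ xiQ_noise z nQ)).
Qed.

Lemma integrable_state_bound F2 : integrableR Pr (state_bound F2).
Proof.
apply: integrableRD; first exact: (icount (fun a b => F2 * ((a + b)%N == 0)%:R)).
by apply: eq_integrable (integrableZl measurableT 2 (integrableRD iAP iAQ)).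
Qed.

(** Integrating out the noise replaces each squared noise sum by [sigma ^+ 2] times the visit count.
    The resulting function of the counts is bounded pointwise by [inverse_count_le] and integrated
    with the variance bounds [vP] and [vQ]. *)
Lemma integral_state_bound_le (F2 vP vQ m mP mQ : R) : 0 <= F2 -> 0 < m -> m = mP + mQ ->
  (\int[Pr]_w (((cP w)%:R - mP) ^+ 2)%:E <= vP%:E)%E ->
  (\int[Pr]_w (((cQ w)%:R - mQ) ^+ 2)%:E <= vQ%:E)%E ->
  (\int[Pr]_w (state_bound F2 w)%:E
    <= (4 * sigma ^+ 2 / m + 2 * (F2 + 8 * sigma ^+ 2) / m ^+ 2 * (vP + vQ))%:E)%E.
Proof.
move=> F20 m0 mE vPle vQle.
pose phi (a b : nat) : R := ((a + b)%:R ^+ 2)^-1.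
have phi0 a b : 0 <= phi a b by rewrite invr_ge0 sqr_ge0.
have wP : (\int[Pr]_w (phi (cP w) (cQ w) * AP w ^+ 2)%:E
    <= (sigma ^+ 2)%:E * \int[Pr]_w (phi (cP w) (cQ w) * (cP w)%:R)%:E)%E.
  exact (noise_sum_weighted mXP xiP_noise z nP indepPQ GQm cQ_le GcQ phi0).
have wQ : (\int[Pr]_w (phi (cP w) (cQ w) * AQ w ^+ 2)%:E
    <= (sigma ^+ 2)%:E * \int[Pr]_w (phi (cP w) (cQ w) * (cQ w)%:R)%:E)%E.
  (* The one-chain lemma is reused with the two chains exchanged, which the symmetry of the weight
     permits. *)
  have phiC a b : phi a b = phi b a by rewrite /phi addnC.
  have := noise_sum_weighted mXQ xiQ_noise z nQ indepQP GPm cP_le GcP phi0.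
  rewrite -/cQ; under eq_integral do rewrite phiC.
  by under [X in (_ <= _ * X)%E]eq_integral do rewrite phiC.
have i0 := icount (fun a b => F2 * ((a + b)%N == 0)%:R).
have iP := icount (fun a b => phi a b * a%:R).
have iQ := icount (fun a b => phi a b * b%:R).
have iDP := icount (fun a b => (a%:R - mP) ^+ 2).
have iDQ := icount (fun a b => (b%:R - mQ) ^+ 2).
have s20 : 0 <= sigma ^+ 2 by exact: sqr_ge0.
set B := 2 * (F2 + 8 * sigma ^+ 2) / m ^+ 2.
have B0 : 0 <= B by rewrite /B divr_ge0 ?sqr_ge0// mulr_ge0// addr_ge0// mulr_ge0.
have iZ (k : R) (g : Omega -> R) : integrableR Pr g -> integrableR Pr (fun w => k * g w).
  by move=> ig; apply: eq_integrable (integrableZl measurableT k ig).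
have iA := integrableRD iAP iAQ.
have iPQ := integrableRD iP iQ.
have iD := integrableRD iDP iDQ.
rewrite /state_bound integralRD//; last exact: iZ.
rewrite [X in (_ + X <= _)%E]integralRZ// [X in (_ + _ * X <= _)%E]integralRD//.
apply: (@le_trans _ _ (\int[Pr]_w (F2 * ((cP w + cQ w)%N == 0)%:R
    + 2 * sigma ^+ 2 * (phi (cP w) (cQ w) * (cP w)%:R + phi (cP w) (cQ w) * (cQ w)%:R))%:E)%E).
  rewrite integralRD//; last exact: iZ.
  rewrite leeD2l// integralRZ//.
  rewrite EFinM -muleA lee_wpmul2l// integralRD//.
  rewrite ge0_muleDr; [exact: leeD| |].
  - by apply: integral_ge0 => w _; rewrite lee_fin mulr_ge0.
  - by apply: integral_ge0 => w _; rewrite lee_fin mulr_ge0.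
apply: (@le_trans _ _ (\int[Pr]_w (4 * sigma ^+ 2 / m
    + B * (((cP w)%:R - mP) ^+ 2 + ((cQ w)%:R - mQ) ^+ 2))%:E)%E).
  apply: le_integral => //.
  - exact: (icount (fun a b => F2 * ((a + b)%N == 0)%:R
      + 2 * sigma ^+ 2 * (phi a b * a%:R + phi a b * b%:R))).
  - exact: (icount (fun a b => 4 * sigma ^+ 2 / m
      + B * ((a%:R - mP) ^+ 2 + (b%:R - mQ) ^+ 2))).
  - by move=> w _; rewrite lee_fin; exact: inverse_count_le.
rewrite integralRD; [|exact: integrableR_cst|exact: iZ].
rewrite [X in (_ + X <= _)%E]integralRZ//.
rewrite integralRD// integral_cst// [X in (_ * X + _)%E](_ : _ = 1%E); last exact: probability_setT.
rewrite mule1 EFinD leeD2l//.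
rewrite [leRHS]EFinM; apply: lee_wpmul2l; first by rewrite lee_fin.
by rewrite EFinD; exact: leeD.
Qed.

End StateRisk.

(** Another point [u] of the ball would be at a distance at most [c * min_dist x], hence at most [c]
    times its own distance to [x j], which is impossible for [c < 1]. Having two states makes the
    infimum nonnegative, so that the center lies in the ball. *)
Lemma closed_metric_ball_set1 (R : realType) (T : metricType R) (K : nat)
    (x : 'I_K -> T) (a c : R) (j : 'I_K) : (2 <= K)%N -> bijective x ->
  0 <= a -> 0 < c -> c < 1 ->
  closed_metric_ball (x j) (c * Num.min a (min_dist x)) = [set x j].
Proof.
move=> K2 [y xK yK] a0 c0 c1.
set S := [set r | exists i k, i != k /\ r = mdist (x i) (x k)].
have lbS : lbound S 0 by move=> _ [i [k [_ ->]]]; exact: mdist_ge0.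
have S0 : nonempty S.
  have K0 : (0 < K)%N by exact: ltnW.
  by exists (mdist (x (Ordinal K0)) (x (Ordinal K2))), (Ordinal K0), (Ordinal K2).
have d0 : 0 <= min_dist x by exact: lb_le_inf.
apply/seteqP; split=> u /=; last first.
  by move=> ->; rewrite /closed_metric_ball /= mdistxx mulr_ge0 ?(ltW c0)// le_min a0.
rewrite /closed_metric_ball /= => ju; apply/eqP/negPn/negP => uj.
have D0 : 0 < mdist (x j) u by rewrite mdist_gt0 eq_sym.
have dD : min_dist x <= mdist (x j) u.
  apply: ge_inf; first by exists 0.
  exists j, (y u); split; last by rewrite yK.
  by apply: contra uj => /eqP ->; rewrite yK.
suff : mdist (x j) u < mdist (x j) u by rewrite ltxx.
apply: (le_lt_trans ju); apply: (@le_lt_trans _ _ (c * mdist (x j) u)).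
  by rewrite ler_wpM2l ?(ltW c0)// ge_min dD orbT.
by rewrite -[ltRHS]mul1r ltr_pM2r.
Qed.

Theorem proposition5p1 (R : realType)
    (T : metricType R) (K : nat) (x : 'I_K -> T)
    (K_ge2 : (2 <= K)%N) (x_bij : bijective x)
    (P Q : 'M[R]_K) (piP piQ muP muQ : 'rV[R]_K)
    (P_stoch : stochastic P) (Q_stoch : stochastic Q)
    (P_irr : irreducible P) (Q_irr : irreducible Q)
    (P_aper : aperiodic P) (Q_aper : aperiodic Q)
    (P_inv : invariant_distribution P piP)
    (Q_inv : invariant_distribution Q piQ)
    (P_rev : reversible P piP) (Q_rev : reversible Q piQ)
    (muP_distr : distribution_vector muP) (muQ_distr : distribution_vector muQ)
    (d : measure_display) (Omega : measurableType d) (Pr : probability Omega R)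
    (XP XQ : nat -> Omega -> T)
    (XP_markov : markov_chain Pr x muP P XP)
    (XQ_markov : markov_chain Pr x muQ Q XQ)
    (XPQ_indep : independent_systems Pr (sigma_chain XP) (sigma_chain XQ))
    (xiP xiQ : nat -> Omega -> R) (sigma : R) (sigma_gt0 : 0 < sigma)
    (PQ_indep : independent_systems Pr
      (sigma_chain_noise XP xiP) (sigma_chain_noise XQ xiQ))
    (xiP_noise : noise_given_chain Pr XP xiP sigma)
    (xiQ_noise : noise_given_chain Pr XQ xiQ sigma)
    (nP nQ : nat)
    (nP_large : (1 - second_abs_eigenvalue P ^+ 2)^-1 <= nP%:R)
    (nQ_large : (1 - second_abs_eigenvalue Q ^+ 2)^-1 <= nQ%:R)
    (f : T -> R) (c : R) (c_gt0 : 0 < c) (c_lt1 : c < 1) :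
  let neff := effective_size nP nQ piP piQ in
  let h := c * Num.min (neff `^ (- 2^-1)) (min_dist x) in
  let X := concat_sample nP XP XQ in
  let xi := concat_sample nP xiP xiQ in
  let Y := fun i w => f (X i w) + xi i w in
  let fhat := nadaraya_watson (nP + nQ) h X Y in
  ('E_Pr[(fun w => sq_L2_norm x piQ (fun y => fhat w y - f y))%R] <=
   ((c ^+ 2 * Lbar x f ^+ 2
     + K%:R * max_ratio piQ piP * constC P Q muP muQ piP piQ
       * (sup_norm x f ^+ 2 + sigma ^+ 2)) / neff)%:E)%E.
Proof.
rewrite /effective_size /constC; cbv zeta.
have [y xK yK] := x_bij.
have p0 := invariant_gt0 P_irr P_stoch P_inv.
have q0 := invariant_gt0 Q_irr Q_stoch Q_inv.
have [[mXP _ _] [mXQ _ _]] := (XP_markov, XQ_markov).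
have lP0 : 0 <= second_abs_eigenvalue P.
  exact: second_abs_eigenvalue_ge0 P_stoch P_irr P_aper P_inv P_rev.
have lP1 : second_abs_eigenvalue P < 1.
  exact: second_abs_eigenvalue_lt1 P_stoch P_irr P_aper P_inv P_rev.
have lQ0 : 0 <= second_abs_eigenvalue Q.
  exact: second_abs_eigenvalue_ge0 Q_stoch Q_irr Q_aper Q_inv Q_rev.
have lQ1 : second_abs_eigenvalue Q < 1.
  exact: second_abs_eigenvalue_lt1 Q_stoch Q_irr Q_aper Q_inv Q_rev.
have varP := occupation_variance_le P_stoch P_irr P_aper P_inv P_rev muP nP.
have varQ := occupation_variance_le Q_stoch Q_irr Q_aper Q_inv Q_rev muQ nQ.
have kP1 : 1 <= max_ratio muP piP by apply: max_ratio_ge1 => //; case: P_inv.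
have kQ1 : 1 <= max_ratio muQ piQ by apply: max_ratio_ge1 => //; case: Q_inv.
have rho1 : 1 <= max_ratio piQ piP by apply: max_ratio_ge1 => //; [case: Q_inv|case: P_inv].
have rho_ge := max_ratio_ge piQ piP.
(* Abstracted so that no unification problem unfolds the eigenvalues below. *)
move: (second_abs_eigenvalue P) (second_abs_eigenvalue Q) (max_ratio muP piP)
  (max_ratio muQ piQ) (max_ratio piQ piP) lP0 lP1 lQ0 lQ1 nP_large nQ_large
  varP varQ kP1 kQ1 rho1 rho_ge.
move=> lP lQ kP kQ rho lP0 lP1 lQ0 lQ1 nP_large nQ_large varP varQ kP1 kQ1 rho1 rho_ge.
set neff := nP%:R / rho + nQ%:R; set h := c * Num.min _ _.
set fhat := nadaraya_watson _ _ _ _.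
have gap_ge1 (l : R) : 0 <= l -> l < 1 -> 1 <= (1 - l ^+ 2)^-1.
  move=> l0 l1; have l2 : l ^+ 2 < 1 by rewrite expr_lt1.
  by rewrite invf_ge1 ?subr_gt0// gerBl sqr_ge0.
have aP1 := gap_ge1 _ lP0 lP1; have aQ1 := gap_ge1 _ lQ0 lQ1.
have nP1 : 1 <= nP%:R :> R := le_trans aP1 nP_large.
have nQ1 : 1 <= nQ%:R :> R := le_trans aQ1 nQ_large.
have rho0 : 0 < rho by exact: lt_le_trans rho1.
set gP := kP * (1 - lP ^+ 2)^-1.
set gQ := kQ * (1 - lQ ^+ 2)^-1.
(* One factor controls both visit variances relative to their stationary means; being at least 1, it
   also absorbs terms without such a factor. *)
pose g := Num.max gP gQ.
have gPg : gP <= g by rewrite /g le_max lexx.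
have gQg : gQ <= g by rewrite /g le_max lexx orbT.
have g1 : 1 <= g by apply: le_trans gPg; rewrite /gP -[leLHS]mulr1 ler_pM.
have neff0 : 0 < neff.
  apply: ltr_wpDl (lt_le_trans ltr01 nQ1).
  by rewrite divr_ge0// (ltW rho0).
have neffE : neff = nP%:R / rho + nQ%:R by [].
have s0 : 0 <= sigma ^+ 2 by exact: sqr_ge0.
pose F2 := sup_norm x f ^+ 2.
have F20 : 0 <= F2 by exact: sqr_ge0.
have fF j : f (x j) ^+ 2 <= F2.
  rewrite /F2 -[leLHS]real_normK ?num_real// ler_sqr ?nnegrE//.
    by rewrite /sup_norm le_bigmax.
  by rewrite /sup_norm; exact: bigmax_ge_id.
have hball j : closed_metric_ball (x j) h = [set x j].
  by apply: closed_metric_ball_set1 => //; exact: powR_ge0.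
pose bound j := state_bound XP XQ xiP xiQ (x j) nP nQ F2.
have ibound j : integrableR Pr (bound j).
  exact (integrable_state_bound mXP mXQ xiP_noise xiQ_noise (x j) nP nQ F2).
have Ebound j : (\int[Pr]_w (bound j w)%:E
    <= (68 * g * (F2 + sigma ^+ 2) / (nP%:R * piP 0 j + nQ%:R * piQ 0 j))%:E)%E.
  set mP := nP%:R * piP 0 j; set mQ := nQ%:R * piQ 0 j.
  have mP0 : 0 < mP by rewrite mulr_gt0// (lt_le_trans ltr01).
  have mQ0 : 0 < mQ by rewrite mulr_gt0// (lt_le_trans ltr01).
  have m0 : 0 < mP + mQ by rewrite addr_gt0.
  have vP : (\int[Pr]_w (((hits XP (x j) nP w)%:R - mP) ^+ 2)%:E <= (4 * gP * mP)%:E)%E.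
    under eq_integral do rewrite hitsE.
    have := integral_occupation xK yK XP_markov piP nP j.
    rewrite /visit => ->; rewrite lee_fin.
    exact: varP.
  have vQ : (\int[Pr]_w (((hits XQ (x j) nQ w)%:R - mQ) ^+ 2)%:E <= (4 * gQ * mQ)%:E)%E.
    under eq_integral do rewrite hitsE.
    have := integral_occupation xK yK XQ_markov piQ nQ j.
    rewrite /visit => ->; rewrite lee_fin.
    exact: varQ.
  apply: (le_trans (integral_state_bound_le mXP mXQ xiP_noise xiQ_noise PQ_indep
    F20 m0 erefl vP vQ)).
  rewrite lee_fin; set m := mP + mQ.
  have v_le : 4 * gP * mP + 4 * gQ * mQ <= 4 * g * m.
    by rewrite /m mulrDr lerD// ler_wpM2r ?(ltW mP0) ?(ltW mQ0)// ler_pM2l.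
  apply: (@le_trans _ _ (4 * sigma ^+ 2 / m
      + 2 * (F2 + 8 * sigma ^+ 2) / m ^+ 2 * (4 * g * m))).
    rewrite lerD2l ler_wpM2l// divr_ge0 ?sqr_ge0// mulr_ge0// addr_ge0// mulr_ge0//.
  have -> : 4 * sigma ^+ 2 / m + 2 * (F2 + 8 * sigma ^+ 2) / m ^+ 2 * (4 * g * m)
      = (4 * sigma ^+ 2 + 8 * g * (F2 + 8 * sigma ^+ 2)) / m.
    by field; rewrite gt_eqF.
  (* As [g >= 1], the term [4 * sigma ^+ 2] is at most [4 * g * sigma ^+ 2]; added to
     [64 * g * sigma ^+ 2] it gives the constant 68, which also dominates the 8 in front of
     [g * F2]. *)
  rewrite ler_wpM2r ?invr_ge0 ?(ltW m0)//.
  have gs : 0 <= (g - 1) * sigma ^+ 2 by rewrite mulr_ge0 ?subr_ge0.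
  have gF : 0 <= g * F2 by rewrite mulr_ge0// (le_trans ler01 g1).
  by lra.
have mfhat j : measurable_fun setT (fun w => fhat w (x j)).
  exact (measurable_nadaraya_watson mXP mXQ xiP_noise xiQ_noise f nP nQ (hball j)).
rewrite unlock.
apply: (@le_trans _ _ (\int[Pr]_w (\sum_j piQ 0 j * bound j w)%:E)%E).
  apply: ge0_le_integral => //.
  - by move=> w _; rewrite lee_fin sumr_ge0// => j _; rewrite mulr_ge0 ?sqr_ge0 ?(ltW (q0 j)).
  - apply/measurable_EFinP; apply: measurable_sum => j; apply: measurable_funM => //.
    by apply: measurable_funX; exact: measurable_funB.
  - by apply/measurable_EFinP; apply: measurable_sum => j; apply: measurable_funM => //;
      exact: integrableR_measurable (ibound j).
  - move=> w _; rewrite lee_fin; apply: ler_sum => j _; rewrite ler_wpM2l ?(ltW (q0 j))//.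
    exact (risk_le_state_bound XP XQ xiP xiQ nP nQ (hball j) w (fF j)).
have iZ j : integrableR Pr (fun w => piQ 0 j * bound j w).
  by apply: eq_integrable (integrableZl measurableT (piQ 0 j) (ibound j)).
rewrite integralR_sum//.
pose V := 68 * g * (F2 + sigma ^+ 2).
have V0 : 0 <= V.
  by rewrite /V mulr_ge0 ?addr_ge0// mulr_ge0// (le_trans ler01 g1).
(* Each state contributes at most [V / neff]: from [piQ 0 j / rho <= piP 0 j], the expected visit
   count is at least [piQ 0 j * neff]. *)
apply: (@le_trans _ _ (\sum_(j < K) (V / neff)%:E)%E).
  apply: lee_sum => j _; rewrite integralRZ//.
  apply: (@le_trans _ _ ((piQ 0 j)%:E * (V / (nP%:R * piP 0 j + nQ%:R * piQ 0 j))%:E)%E).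
    by apply: lee_wpmul2l => //; rewrite lee_fin (ltW (q0 j)).
  rewrite -EFinM lee_fin mulrCA ler_wpM2l//.
  have m0 : 0 < nP%:R * piP 0 j + nQ%:R * piQ 0 j.
    by rewrite addr_gt0// mulr_gt0// (lt_le_trans ltr01).
  rewrite ler_pdivrMr// mulrC ler_pdivlMr// neffE mulrDr lerD//; last by rewrite mulrC.
  have rj : piQ 0 j / rho <= piP 0 j.
    by rewrite ler_pdivrMr// mulrC -ler_pdivrMr.
  by rewrite mulrCA ler_wpM2l// (le_trans ler01 nP1).
rewrite sumEFin lee_fin sumr_const card_ord -[leLHS]mulr_natl mulrA.
apply: ler_wpM2r; first by rewrite invr_ge0 (ltW neff0).
set C := 12 * _.
(* The Lipschitz summand is nonnegative, so it suffices to stay below the other one. *)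
apply: (@le_trans _ _ (K%:R * rho * C * (F2 + sigma ^+ 2))); last first.
  by rewrite lerDr mulr_ge0 ?sqr_ge0.
(* The second entry of the maximum in the constant is [28 * g], and [12 * 28 = 336] exceeds the 68
   obtained above. *)
have C_ge : 336 * g <= C.
  have -> : 336 * g = 12 * (28 * g) by ring.
  by rewrite ler_pM2l// le_max lexx orbT.
clearbody C.
have S0 : 0 <= F2 + sigma ^+ 2 by rewrite addr_ge0.
have gS0 : 0 <= g * (F2 + sigma ^+ 2) by rewrite mulr_ge0// (le_trans ler01 g1).
have CS : 336 * g * (F2 + sigma ^+ 2) <= C * (F2 + sigma ^+ 2) by apply: ler_wpM2r.
rewrite -!mulrA ler_wpM2l//.
apply: (@le_trans _ _ (C * (F2 + sigma ^+ 2))).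
  by apply: le_trans CS; rewrite /V -!mulrA ler_wpM2r// ler_nat.
apply: ler_peMl; last exact: rho1.
apply: le_trans CS; rewrite -mulrA; exact: mulr_ge0 (ler0n _ _) gS0.
Qed.
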